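(* Let $r>0$ and let $B_T=\int_0^T W^r_t\,dt$ be the area of reset Brownian motion with reset rate $r$. For every $T\in(0,\infty)$, all odd moments of $B_T$ vanish and all even moments of $B_T$ are non-vanishing. The first two even moments are $$\mathbb{E}_r[B_T^2]=\frac{2}{r^3}\left(rT-2+e^{-rT}(2+rT)\right),$$ $$\mathbb{E}_r[B_T^4]=\frac{1}{r^6}\left(12(rT)^2+120\,rT-840+e^{-rT}\big[9(rT)^4+68(rT)^3+288(rT)^2+720\,rT+840\big]\right).$$
   Context: Reset Brownian motion (rBM): given a Poisson process on $[0,\infty)$ of intensity $r>0$, the process $(W^r_t)_{t\ge 0}$ starts at $0$, evolves as a standard Brownian motion on $\mathbb{R}$, and at each Poisson point is placed back at $0$, from where it continues as a fresh standard Brownian motion started at $0$; the successive Brownian pieces are independent of each other and of the Poisson process. $\mathbb{E}_r$ denotes expectation for rBM with rate $r$. *)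

(* Defs.v *)
From HB Require Import structures.
From mathcomp Require Export all_boot all_order all_algebra.
From mathcomp Require Export all_classical all_reals all_analysis.
Export Order.TTheory GRing.Theory Num.Theory.
Export numFieldNormedType.Exports.

Set Implicit Arguments.
Unset Strict Implicit.
Unset Printing Implicit Defensive.

Local Open Scope classical_set_scope.
Local Open Scope ring_scope.

Definition mutually_independent (d : measure_display) (Omega : measurableType d)
    (R : realType) (P : probability Omega R) (I : eqType)
    (F : I -> set_system Omega) : Prop :=
  forall (s : seq I) (A : I -> set Omega), uniq s ->
    (forall i, i \in s -> F i (A i)) ->
    P (\bigcap_(i in [set` s]) A i) = (\prod_(i <- s) P (A i))%E.

(* sigma(X) *)
Definition sigma_rv (d d' : measure_display) (Omega : measurableType d)
    (E : measurableType d') (X : Omega -> E) : set_system Omega :=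
  preimage_set_system setT X measurable.

(* sigma(X_t ; t >= 0) *)
Definition sigma_process (d d' : measure_display) (Omega : measurableType d)
    (E : measurableType d') (R : realType) (X : R -> Omega -> E) :
    set_system Omega :=
  <<s \bigcup_(t in `[0, +oo[) sigma_rv (X t) >>.

(* Processes are indexed by the whole of R, but only the times t >= 0 are
   constrained, here and below.  A finite partition t_0 <= ... <= t_n is covered
   by extending it with t_i = t_n, the extra increments being 0.  The second
   parameter of normal_prob is the standard deviation. *)
Record standard_brownian_motion (d : measure_display) (Omega : measurableType d)
    (R : realType) (P : probability Omega R) (X : R -> {RV P >-> R}) : Prop := {
  bm_start : forall w, X 0 w = 0 ;
  bm_continuous : forall w, {within `[0, +oo[, continuous (fun t => X t w)} ;
  bm_indep_incr : forall t : nat -> R, 0 <= t 0%N ->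
    (forall i, t i <= t i.+1) ->
    mutually_independent P
      (fun i => sigma_rv (fun w => X (t i.+1) w - X (t i) w)) ;
  bm_normal_incr : forall (s t : R) (U : set R), 0 <= s -> s < t ->
    measurable U ->
    P ((fun w => X t w - X s w) @^-1` U) = normal_prob 0 (Num.sqrt (t - s)) U
}.

(* A Poisson process given by its counting process: N t is the number of
   Poisson points in [0, t]. *)
Record poisson_process (d : measure_display) (Omega : measurableType d)
    (R : realType) (P : probability Omega R) (r : R)
    (N : R -> {RV P >-> nat}) : Prop := {
  pp_start : forall w, N 0 w = 0%N ;
  pp_nondecreasing : forall w (s t : R), 0 <= s -> s <= t ->
    (N s w <= N t w)%N ;
  pp_right_continuous : forall w (t : R), 0 <= t ->
    \forall s \near t^'+, N s w = N t w ;
  pp_indep_incr : forall t : nat -> R, 0 <= t 0%N ->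
    (forall i, t i <= t i.+1) ->
    mutually_independent P
      (fun i => sigma_rv (fun w => (N (t i.+1) w - N (t i) w)%N)) ;
  pp_poisson_incr : forall (s t : R) (k : nat), 0 <= s -> s < t ->
    P [set w | (N t w - N s w)%N = k] = (poisson_pmf (r * (t - s)) k)%:E
}.

(* The last Poisson point in [0, t], or 0 if there is none: N is a
   right-continuous step function, so this is where its current value was
   first reached. *)
Definition last_reset (d : measure_display) (Omega : measurableType d)
    (R : realType) (P : probability Omega R) (N : R -> {RV P >-> nat})
    (t : R) (w : Omega) : R :=
  inf [set s : R | 0 <= s /\ N s w = N t w].

(* The piece started after the k-th reset (k = 0 for the initial one) follows
   B k, run from time 0 on.  Independence is that of the sigma-algebras of N
   (index None) and of the B k (index Some k), all of them jointly. *)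
Definition reset_brownian_motion (d : measure_display)
    (Omega : measurableType d) (R : realType) (P : probability Omega R) (r : R)
    (W : R -> Omega -> R) : Prop :=
  exists (N : R -> {RV P >-> nat}) (B : nat -> R -> {RV P >-> R}),
  [/\ poisson_process r N,
      forall k, standard_brownian_motion (B k),
      mutually_independent P (fun i : option nat =>
        if i is Some k then sigma_process (B k : R -> Omega -> R)
        else sigma_process (N : R -> Omega -> nat)) &
      forall t w, 0 <= t -> W t w = B (N t w) (t - last_reset N t w) w].

Definition area (Omega : Type) (R : realType) (W : R -> Omega -> R) (T : R)
    (w : Omega) : R :=
  \int[lebesgue_measure]_(t in `[0, T]) W t w.

Definition moment (d : measure_display) (Omega : measurableType d)
    (R : realType) (P : probability Omega R) (X : Omega -> R) (n : nat) :
    \bar R :=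
  ('E_P[fun w => (X w ^+ n)%R])%E.

(* Main.v *)
From HB Require Import structures.
Require Import Defs.
From mathcomp Require Import measurable_realfun.
From mathcomp Require Import ring lra zify.

Set Implicit Arguments.
Unset Strict Implicit.
Unset Printing Implicit Defensive.

Local Open Scope classical_set_scope.
Local Open Scope ring_scope.

(* Fix a mesh h and observe the path at the times j h. Replacing the last reset
   by the first grid point after it gives a chain with V_0 = 0 and
   V_(j+1) = beta_j (V_j + xi_j), where the xi_j are centred Gaussian of
   variance h, the beta_j are Bernoulli of parameter exp(- r h) (no reset during
   the step), and all of them are independent. With A_(j+1) = A_j + h V_j, the
   mixed moments E(A_j^a V_j^b) satisfy a closed linear recursion: those with
   a + b odd vanish, and those with a + b = 2 or 4 form the Euler scheme of a
   triangular system of linear differential equations with explicit solution.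
   As h = T / (m + 1) tends to 0, A tends to the area along every path, because
   the path is bounded and right-continuous; uniform bounds on the even moments,
   from a discrete Gronwall inequality, turn this into convergence of all
   moments. Even moments are nonzero because the second one is positive. *)

(** * Random variables with finite moments *)

(** Rounding the last reset up to the grid makes the position at a grid time depend on the Poisson
    process only through its values at grid times. Conditioning on these is a countable sum, in each
    term of which the steps are increments of fixed Brownian motions; the exact reset time would be
    a continuous random variable. A survival is 0 or 1, so [beta_j ^+ b = beta_j] for [b > 0]:
    moments with [b > 0] are all damped at the same rate [r], those with [b = 0] not at all. In the
    limit, [M_(a,b)' = a M_(a-1,b+1) + b (b - 1) / 2 M_(a,b-2) - r M_(a,b)], the last term being
    present for [b > 0] only. Only the variance of a step enters this system; its fourth moment is
    of order [h ^+ 2] and falls into the remainder of the Euler scheme. *)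

Section all_moments.
Context (d : measure_display) (Omega : measurableType d) (R : realType)
  (P : probability Omega R).
Implicit Types X Y Z : Omega -> R.

(** Unlike a fixed L^p space, this class is stable under products, so integrability of any
    polynomial in the chain reduces to that of the steps and survivals. *)
Definition all_moments (Z : Omega -> R) : Prop :=
  measurable_fun setT Z /\
  forall k, P.-integrable setT (EFin \o (fun w => `|Z w| ^+ k)).

(** Real-valued, so that recursions between moments are ring identities; an infinite integral would
    be read as 0, hence the integrability conditions around it. *)
Definition mean (Z : Omega -> R) : R := \int[P]_w Z w.

Lemma all_moments_measurable Z : all_moments Z -> measurable_fun setT Z.
Proof. by case. Qed.

Lemma integrable_le X Y : measurable_fun setT X ->
  (forall w, `|X w| <= Y w) -> P.-integrable setT (EFin \o Y) ->
  P.-integrable setT (EFin \o X).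
Proof.
move=> mX XY; apply: le_integrable => //; first exact/measurable_EFinP.
move=> w _ /=; by rewrite lee_fin (le_trans (XY w))// ler_norm.
Qed.

Lemma all_moments_integrable Z : all_moments Z ->
  P.-integrable setT (EFin \o Z).
Proof.
by case=> mZ /(_ 1%N); apply: integrable_le => // w; rewrite expr1.
Qed.

Lemma all_moments_bounded (c : R) Z : measurable_fun setT Z ->
  (forall w, `|Z w| <= c) -> all_moments Z.
Proof.
move=> mZ Zc; split=> // k.
apply: (@integrable_le _ (fun=> c ^+ k)).
- by apply: measurable_funX; apply: measurableT_comp.
- by move=> w; rewrite normrX normr_id; apply: lerXn2r; rewrite ?nnegrE ?(le_trans _ (Zc w)).
- exact: finite_measure_integrable_cst.
Qed.

Lemma all_moments_cst (c : R) : all_moments (fun=> c).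
Proof. exact: (@all_moments_bounded `|c|). Qed.

Lemma all_momentsD X Y : all_moments X -> all_moments Y ->
  all_moments (fun w => X w + Y w).
Proof.
move=> [mX iX] [mY iY]; split; first exact: measurable_funD.
move=> k.
apply: (@integrable_le _ (fun w => 2 ^+ k * `|X w| ^+ k + 2 ^+ k * `|Y w| ^+ k)).
- apply: measurable_funX; apply: measurableT_comp => //.
  exact: measurable_funD.
- move=> w; rewrite normrX normr_id -mulrDr.
  have h : `|X w + Y w| <= 2 * Num.max `|X w| `|Y w|.
    rewrite (le_trans (ler_normD _ _))//.
    by rewrite mulr_natl mulr2n lerD// le_max lexx ?orbT.
  apply: (@le_trans _ _ ((2 * Num.max `|X w| `|Y w|) ^+ k)).
    by apply: lerXn2r => //; rewrite nnegrE ?(le_trans _ h).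
  rewrite exprMn ler_pM2l ?exprn_gt0//.
  by case: (lerP `|X w| `|Y w|) => _; rewrite ?lerDl ?lerDr exprn_ge0.
- under [X in integrable _ _ X]eq_fun do rewrite /= EFinD !EFinM.
  apply: (@integrableD _ _ _ _ _ measurableT (fun w => (2 ^+ k)%:E * (`|X w| ^+ k)%:E)%E
    (fun w => (2 ^+ k)%:E * (`|Y w| ^+ k)%:E)%E).
    exact: (integrableZl _ _ (iX k)).
  exact: (integrableZl _ _ (iY k)).
Qed.

Lemma all_momentsM X Y : all_moments X -> all_moments Y ->
  all_moments (fun w => X w * Y w).
Proof.
move=> [mX iX] [mY iY]; split; first exact: measurable_funM.
move=> k.
apply: (@integrable_le _ (fun w => `|X w| ^+ (k * 2) + `|Y w| ^+ (k * 2))).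
- apply: measurable_funX; apply: measurableT_comp => //.
  exact: measurable_funM.
- move=> w; rewrite normrX normr_id normrM exprMn !exprM.
  set a := _ ^+ k; set b := _ ^+ k.
  (* Expanded, this is twice the inequality [a * b <= a ^+ 2 + b ^+ 2]. *)
  have : 0 <= (a - b) ^+ 2 + a ^+ 2 + b ^+ 2.
    by rewrite !addr_ge0// sqr_ge0.
  rewrite sqrrB; nra.
- under [X in integrable _ _ X]eq_fun do rewrite /= EFinD.
  exact: (integrableD _ (iX (k * 2)%N) (iY (k * 2)%N)).
Qed.

Lemma all_momentsX n X : all_moments X -> all_moments (fun w => X w ^+ n).
Proof.
move=> aX; elim: n => [|n ih]; first exact: all_moments_cst.
by under eq_fun do rewrite exprS; exact: all_momentsM.
Qed.

Lemma all_moments_sum (I : Type) (s : seq I) (F : I -> Omega -> R) :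
  (forall i, all_moments (F i)) -> all_moments (fun w => \sum_(i <- s) F i w).
Proof.
move=> aF; elim: s => [|i s ih].
  by under eq_fun do rewrite big_nil; exact: all_moments_cst.
by under eq_fun do rewrite big_cons; exact: all_momentsD.
Qed.

Lemma expectation_mean Z : all_moments Z -> ('E_P[Z] = (mean Z)%:E)%E.
Proof.
move=> aZ; rewrite /mean /Rintegral unlock fineK//.
exact: (integrable_fin_num _ (all_moments_integrable aZ)).
Qed.

Lemma mean_cst (c : R) : mean (fun=> c) = c.
Proof. by rewrite /mean Rintegral_cst//= probability_setT mulr1. Qed.

Lemma meanD X Y : all_moments X -> all_moments Y ->
  mean (fun w => X w + Y w) = mean X + mean Y.
Proof. by move=> aX aY; apply: RintegralD => //; exact: all_moments_integrable. Qed.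

Lemma meanZ (c : R) X : all_moments X -> mean (fun w => c * X w) = c * mean X.
Proof. by move=> aX; apply: RintegralZl => //; exact: all_moments_integrable. Qed.

Lemma mean_sum (I : Type) (s : seq I) (F : I -> Omega -> R) :
  (forall i, all_moments (F i)) ->
  mean (fun w => \sum_(i <- s) F i w) = \sum_(i <- s) mean (F i).
Proof.
move=> aF; elim: s => [|i s ih].
  by under eq_fun do rewrite big_nil; rewrite mean_cst big_nil.
under eq_fun do rewrite big_cons.
by rewrite big_cons meanD// ?ih//; exact: all_moments_sum.
Qed.

Lemma mean_ge0 X : (forall w, 0 <= X w) -> 0 <= mean X.
Proof. by move=> X0; exact: Rintegral_ge0. Qed.

Lemma mean_le X Y : all_moments X -> all_moments Y ->
  (forall w, X w <= Y w) -> mean X <= mean Y.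
Proof. by move=> aX aY XY; apply: le_Rintegral => //; exact: all_moments_integrable. Qed.

Lemma norm_mean_le X : all_moments X -> `|mean X| <= mean (fun w => `|X w|).
Proof. by move=> aX; apply: le_normr_Rintegral => //; exact: all_moments_integrable. Qed.

(** On rectangles the law of the pair agrees with the product of the two laws, hence it does
    everywhere; Fubini for [x * y] then separates the factors. *)
Lemma mean_indepM X Y : all_moments X -> all_moments Y ->
  (forall U V, measurable U -> measurable V ->
    P (X @^-1` U `&` Y @^-1` V) = (P (X @^-1` U) * P (Y @^-1` V))%E) ->
  mean (fun w => X w * Y w) = mean X * mean Y.
Proof.
move=> aX aY XY.
have mX := all_moments_measurable aX; have mY := all_moments_measurable aY.
have iX := all_moments_integrable aX; have iY := all_moments_integrable aY.
have iXY := all_moments_integrable (all_momentsM aX aY).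
pose X' : {RV P >-> R} := HB.pack X (@isMeasurableFun.Build _ _ _ _ X mX).
pose Y' : {RV P >-> R} := HB.pack Y (@isMeasurableFun.Build _ _ _ _ Y mY).
pose Z w := (X w, Y w).
have mZ : measurable_fun setT Z by exact/measurable_fun_pair.
pose Z' : {RV P >-> (R * R)%type} := HB.pack Z (@isMeasurableFun.Build _ _ _ _ Z mZ).
pose m1 := distribution P X'; pose m2 := distribution P Y'.
have lawE A : measurable A -> (m1 \x m2)%E A = distribution P Z' A.
  apply: product_measure_unique => U V mU mV.
  by rewrite -XY.
pose f (z : R * R) := (z.1 * z.2)%:E.
have mf : measurable_fun setT f.
  by apply/measurable_EFinP; apply: measurable_funM.
have iP : (m1 \x m2)%E.-integrable setT f.
  apply/integrableP; split => //.
  rewrite (@eq_measure_integral _ _ _ _ (distribution P Z')); last by move=> A mA _; exact: lawE.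
  rewrite ge0_integral_distribution//; last exact: measurableT_comp.
  by case/integrableP: iXY.
have E1 : (\int[P]_w (X w * Y w)%:E = \int[(m1 \x m2)%E]_z f z)%E.
  rewrite (@eq_measure_integral _ _ _ _ (distribution P Z')); last by move=> A mA _; exact: lawE.
  by rewrite integral_distribution.
have E2 : (\int[m2]_y y%:E = (mean Y)%:E)%E.
  rewrite integral_distribution//=.
  rewrite /mean /Rintegral fineK//; exact: integrable_fin_num.
have E3 : (\int[m1]_y y%:E = (mean X)%:E)%E.
  rewrite integral_distribution//=.
  rewrite /mean /Rintegral fineK//; exact: integrable_fin_num.
rewrite {1}/mean /Rintegral E1 -integral12_prod_meas1//.
have idR (Z0 : Omega -> R) (h : measurable_fun setT Z0) : P.-integrable setT (EFin \o Z0) ->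
    (distribution P (HB.pack Z0 (@isMeasurableFun.Build _ _ _ _ Z0 h) : {RV P >-> R})).-integrable setT (EFin \o id).
  move=> iZ0; apply/integrableP; split; first exact/measurable_EFinP.
  rewrite ge0_integral_distribution//; first by case/integrableP: iZ0.
  by apply: measurableT_comp => //; exact/measurable_EFinP.
have -> : (\int[m1]_x fubini_F m2 f x = \int[m1]_x (x%:E * (mean Y)%:E))%E.
  apply: eq_integral => x _; rewrite /fubini_F /f.
  under eq_integral do rewrite /= EFinM.
  by rewrite integralZl//= ?E2//; exact: idR.
by rewrite integralZr ?E3//; exact: idR.
Qed.
End all_moments.

(** * Independence of the past *)

Section past.
Context (d : measure_display) (Omega : measurableType d) (R : realType)
  (P : probability Omega R) (Y : nat -> Omega -> R).
Hypothesis mY : forall i, measurable_fun setT (Y i).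

Definition cylinder (K : nat) (A : set Omega) : Prop :=
  exists2 U : nat -> set R, (forall i, measurable (U i)) &
    A = \bigcap_(i in `I_K) Y i @^-1` U i.

(** Measurability for the sigma-algebra of the first [K] variables, expressed as ordinary
    measurability on another measurable type so that the usual closure rules apply. The cylinders
    generating it form a pi-system. *)
Definition past_measurable (K : nat) (Z : Omega -> R) : Prop :=
  measurable_fun (setT : set (g_sigma_algebraType (cylinder K))) Z.

Lemma cylinder_measurable K : cylinder K `<=` measurable.
Proof.
move=> _ [U mU ->]; apply: fin_bigcap_measurable; first exact: finite_II.
by move=> i _; rewrite -[_ @^-1` _]setTI; exact: mY.
Qed.

Lemma cylinder_setI K : setI_closed (cylinder K).
Proof.
move=> _ _ [U mU ->] [V mV ->]; exists (fun i => U i `&` V i).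
  by move=> i; exact: measurableI.
by rewrite -bigcapI.
Qed.

Lemma cylinder_sub K L : (K <= L)%N -> cylinder K `<=` cylinder L.
Proof.
move=> KL _ [U mU ->]; exists (fun i => if (i < K)%N then U i else setT).
  by move=> i; case: ifP.
apply/seteqP; split=> w /= h i /= iK.
- by case: ifPn => // iK'; exact: h.
- by have := h i (leq_trans iK KL); rewrite iK.
Qed.

Lemma cylinder_preimage K i (U : set R) : (i < K)%N -> measurable U ->
  cylinder K (Y i @^-1` U).
Proof.
move=> iK mU; exists (fun j => if j == i then U else setT).
  by move=> j; case: ifP.
apply/seteqP; split=> w /=.
- by move=> h j /= jK; case: eqP => // ->.
- by move=> /(_ i iK); rewrite eqxx.
Qed.

Lemma past_measurableS K L Z : (K <= L)%N -> past_measurable K Z ->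
  past_measurable L Z.
Proof.
move=> KL pZ _ U mU; have := pZ measurableT U mU.
by apply: sub_sigma_algebra2; exact: cylinder_sub.
Qed.

Lemma past_measurable_coord K i : (i < K)%N -> past_measurable K (Y i).
Proof.
move=> iK _ U mU; rewrite setTI; apply: sub_sigma_algebra.
exact: cylinder_preimage.
Qed.

Lemma past_measurable_cst K (c : R) : past_measurable K (fun=> c).
Proof. exact: measurable_cst. Qed.

Lemma past_measurableD K Z1 Z2 : past_measurable K Z1 -> past_measurable K Z2 ->
  past_measurable K (fun w => Z1 w + Z2 w).
Proof. exact: measurable_funD. Qed.

Lemma past_measurableM K Z1 Z2 : past_measurable K Z1 -> past_measurable K Z2 ->
  past_measurable K (fun w => Z1 w * Z2 w).
Proof. exact: measurable_funM. Qed.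

Lemma past_measurableX K n Z : past_measurable K Z ->
  past_measurable K (fun w => Z w ^+ n).
Proof. exact: measurable_funX. Qed.

Hypothesis indY : mutually_independent P (fun i => sigma_rv (Y i)).

(** For a fixed event [F] on [Y K], both [P (A & F)] and [P F * P A] are finite measures in [A].
    They agree on cylinders by independence, hence on the sigma-algebra these generate. *)
Lemma indep_past K Z (U V : set R) : past_measurable K Z ->
  measurable U -> measurable V ->
  P (Z @^-1` U `&` Y K @^-1` V) = (P (Z @^-1` U) * P (Y K @^-1` V))%E.
Proof.
move=> pZ mU mV.
have mF : measurable (Y K @^-1` V) by rewrite -[_ @^-1` _]setTI; exact: mY.
have PF : P (Y K @^-1` V) = (fine (P (Y K @^-1` V)))%:E.
  by rewrite fineK// fin_num_measure.
have cF : 0 <= fine (P (Y K @^-1` V)) by exact/fine_ge0.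
pose m1 := mrestr P mF; pose m2 := mscale (NngNum cF) P.
have m2E A : m2 A = (P (Y K @^-1` V) * P A)%E by rewrite /m2 /mscale /= -PF.
suff H : forall E, <<s cylinder K >> E -> m1 E = m2 E.
  have := pZ measurableT U mU; rewrite setTI => /H.
  by rewrite m2E /m1 /mrestr muleC.
apply: (@g_sigma_algebra_measure_unique _ _ _ _ (@cylinder_measurable K) (fun=> setT)).
- move=> _; exists (fun=> setT); first by [].
  by apply/seteqP; split.
- by rewrite bigcup_const//; exists 0%N.
- exact: cylinder_setI.
- move=> _ [W mW ->]; rewrite -[LHS]/(m1 _) -[RHS]/(m2 _) m2E /m1 /mrestr.
  (* One family serves for the first [K] indices and for the first [K.+1], where index [K] receives
     [V]. *)
  pose A i := Y i @^-1` (if (i < K)%N then W i else V).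
  have sA i : sigma_rv (Y i) (A i).
    exists (if (i < K)%N then W i else V); first by case: ifP.
    by rewrite setTI.
  have sI L : [set` iota 0 L] = `I_L.
    by apply/seteqP; split=> i /=; rewrite mem_iota add0n.
  have h1 := @indY (iota 0 K.+1) A (iota_uniq _ _) (fun i _ => sA i).
  have h0 := @indY (iota 0 K) A (iota_uniq _ _) (fun i _ => sA i).
  rewrite !sI in h0 h1.
  have e0 : \bigcap_(i in `I_K) A i = \bigcap_(i in `I_K) Y i @^-1` W i.
    by apply: eq_bigcapr => i /= iK; rewrite /A iK.
  have e1 : \bigcap_(i in `I_K.+1) A i =
      (\bigcap_(i in `I_K) Y i @^-1` W i) `&` Y K @^-1` V.
    rewrite -e0; apply/seteqP; split=> w.
      move=> h; split=> [i iK|]; first by apply: h => /=; rewrite (leq_trans iK).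
      by have := h K (ltnSn K); rewrite /A ltnn.
    move=> [h hK] i /=; rewrite ltnS leq_eqVlt => /orP[/eqP->|iK].
      by rewrite /A ltnn.
    exact: h.
  move: h1 h0; rewrite e0 e1 => -> ->.
  rewrite -addn1 iotaD big_cat/= add0n big_seq1 muleC; congr (_ * _)%E.
  by rewrite /A ltnn.
- by move=> _; rewrite /= /m1 /mrestr setTI ltey_eq fin_num_measure.
Qed.

Lemma mean_past_indep K Z (phi : R -> R) : past_measurable K Z ->
  measurable_fun setT phi ->
  all_moments P Z -> all_moments P (fun w => phi (Y K w)) ->
  mean P (fun w => Z w * phi (Y K w)) = mean P Z * mean P (fun w => phi (Y K w)).
Proof.
move=> pZ mphi aZ aY; apply: mean_indepM => // U V mU mV.
apply: (@indep_past K Z U (phi @^-1` V)) => //.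
by rewrite -[_ @^-1` _]setTI; exact: mphi.
Qed.

End past.

(** * Gaussian moments *)

Section normal_prob_integrals.
Context (R : realType).
Implicit Types (s sigma : R).
Local Notation mu := (@lebesgue_measure R).

(** Change of variables yields the Radon-Nikodym derivative; it equals [normal_pdf] almost
    everywhere because both have the same integral over every measurable set. *)
Lemma ge0_integral_normal_prob (m sigma : R) (f : R -> \bar R) :
  measurable_fun setT f -> (forall x, 0 <= f x)%E ->
  (\int[normal_prob m sigma]_x f x =
   \int[mu]_x (f x * (normal_pdf m sigma x)%:E))%E.
Proof.
move=> mf f0; have dom := @normal_prob_dominates R m sigma.
rewrite -(Radon_Nikodym_SigmaFinite.change_of_variables dom)//.
have iF := Radon_Nikodym_SigmaFinite.f_integrable dom.
have mF := measurable_int _ iF.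
have mg : measurable_fun setT (fun x => (normal_pdf m sigma x)%:E).
  by apply/measurable_EFinP; exact: measurable_normal_pdf.
apply: ae_eq_integral => //; try exact: emeasurable_funM.
apply: ae_eqe_mul2l; apply: integral_ae_eq => // A _ mA.
by rewrite -Radon_Nikodym_SigmaFinite.f_integral.
Qed.

(** Up to the factor [s / sigma], the exponential is the ratio of the centred Gaussian densities of
    standard deviations [s] and [sigma]. All moment bounds and the variance are extracted from this
    identity by the choice of [s]. *)
Lemma integral_normal_prob_expsq s sigma : 0 < s -> 0 < sigma ->
  (\int[normal_prob 0 sigma]_x
     (expR (x ^+ 2 / (sigma ^+ 2 *+ 2) - x ^+ 2 / (s ^+ 2 *+ 2)))%:E =
   (s / sigma)%:E)%E.
Proof.
move=> s0 g0.
rewrite ge0_integral_normal_prob; last 2 first.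
- apply/measurable_EFinP; apply: measurableT_comp => //.
  by apply: measurable_funB; apply: measurable_funM => //; exact: measurable_funX.
- by move=> x; rewrite lee_fin expR_ge0.
transitivity (\int[mu]_x ((s / sigma)%:E * (normal_pdf 0 s x)%:E))%E.
  apply: eq_integral => x _; rewrite -!EFinM; congr EFin.
  rewrite !normal_pdfE ?gt_eqF// /normal_fun !subr0 mulrCA -expRD.
  rewrite mulrA.
  rewrite [X in expR X](_ : _ = - x ^+ 2 / (s ^+ 2 *+ 2)); last first.
    by rewrite !mulNr; ring.
  congr (_ * _).
  have peakE t : 0 < t -> normal_peak t = (t * Num.sqrt (pi *+ 2))^-1.
    by move=> t0; rewrite /normal_peak -mulrnAr sqrtrM ?sqr_ge0// sqrtr_sqr ger0_norm// ltW.
  rewrite !peakE//.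
  have : Num.sqrt (pi *+ 2) != 0 :> R by rewrite gt_eqF// sqrtr_gt0 mulrn_wgt0// pi_gt0.
  move: s0 g0 => /gt_eqF/negbT s0 /gt_eqF/negbT g0 p0.
  by field; rewrite s0 g0 p0.
by rewrite integralZl//= ?integral_normal_pdf ?mule1//; exact: integrable_normal_pdf.
Qed.

Lemma normal_prob_oppr sigma (U : set R) : sigma != 0 -> measurable U ->
  normal_prob 0 sigma (-%R @^-1` U) = normal_prob 0 sigma U.
Proof.
move=> g0 mU; rewrite /normal_prob.
rewrite [RHS](@eq_measure_integral _ _ _ _ (pushforward mu (-%R : _ -> measurableTypeR R))); last first.
  by move=> A mA _; apply/esym; exact: lebesgue_measureN.
have mN : measurable_fun (setT : set (measurableTypeR R)) (-%R : _ -> measurableTypeR R).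
  exact: oppr_measurable.
rewrite (ge0_integral_pushforward mN)//.
- apply: eq_integral => x _ /=; congr EFin.
  by rewrite !normal_pdfE// /normal_fun !subr0 sqrrN.
- by apply/measurable_EFinP; apply: measurable_funTS; exact: measurable_normal_pdf.
- by move=> x _; rewrite lee_fin normal_pdf_ge0.
Qed.
End normal_prob_integrals.

Section gaussian_moments.
Context (d : measure_display) (Omega : measurableType d) (R : realType)
  (P : probability Omega R) (sigma : R) (X : Omega -> R).
Hypothesis sigma0 : 0 < sigma.
Hypothesis mX : measurable_fun setT X.
Hypothesis lawX : forall U : set R, measurable U ->
  P (X @^-1` U) = normal_prob 0 sigma U.

Let X' : {RV P >-> measurableTypeR R} := HB.pack X (@isMeasurableFun.Build _ _ _ (measurableTypeR R) X mX).

Lemma ge0_integral_gaussian (f : R -> \bar R) :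
  measurable_fun setT f -> (forall x, 0 <= f x)%E ->
  (\int[P]_w f (X w) = \int[normal_prob 0 sigma]_x f x)%E.
Proof.
move=> mf f0; rewrite -(@ge0_integral_distribution _ _ _ _ _ P X')//.
by apply: eq_measure_integral => U mU _; exact: lawX.
Qed.

Lemma integral_gaussian_expsq s : 0 < s ->
  (\int[P]_w (expR (X w ^+ 2 / (sigma ^+ 2 *+ 2) - X w ^+ 2 / (s ^+ 2 *+ 2)))%:E
   = (s / sigma)%:E)%E.
Proof.
move=> s0; rewrite -integral_normal_prob_expsq// -ge0_integral_gaussian//.
apply/measurable_EFinP; apply: measurableT_comp => //.
by apply: measurable_funB; apply: measurable_funM => //; exact: measurable_funX.
Qed.

(** At [s = sigma * Num.sqrt 2] the exponent is [y = x ^+ 2 / (4 * sigma ^+ 2)], and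
    [y ^+ k <= k! * expR y]; the power of 4 comes from this rescaling. *)
Lemma gaussian_expsq_le k (x : R) :
  x ^+ (2 * k) <= k`!%:R * 4 ^+ k * sigma ^+ (2 * k) *
    expR (x ^+ 2 / (sigma ^+ 2 *+ 2) - x ^+ 2 / ((sigma * Num.sqrt 2) ^+ 2 *+ 2)).
Proof.
have s20 : 0 < sigma ^+ 2 by rewrite exprn_gt0.
rewrite exprMn sqr_sqrtr//.
have -> : x ^+ 2 / (sigma ^+ 2 *+ 2) - x ^+ 2 / (sigma ^+ 2 * 2 *+ 2) =
    x ^+ 2 / (4 * sigma ^+ 2) by field; rewrite gt_eqF.
set y := x ^+ 2 / _.
have y0 : 0 <= y by rewrite divr_ge0 ?sqr_ge0// mulr_ge0// ltW.
have -> : x ^+ (2 * k) = 4 ^+ k * sigma ^+ (2 * k) * y ^+ k.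
  by rewrite !exprM -!exprMn; congr (_ ^+ k); rewrite /y; field; rewrite gt_eqF.
rewrite [leRHS](_ : _ = 4 ^+ k * sigma ^+ (2 * k) * (expR y * k`!%:R)); last by ring.
rewrite ler_pM2l ?mulr_gt0 ?exprn_gt0//.
rewrite -ler_pdivrMr ?ltr0n ?fact_gt0//.
case: k => [|k]; first by rewrite expr0 fact0 divr1 -expR0 ler_expR.
by apply: le_trans (expR_ge1Dxn k y0); rewrite lerDr.
Qed.

Let G w := expR (X w ^+ 2 / (sigma ^+ 2 *+ 2) -
    X w ^+ 2 / ((sigma * Num.sqrt 2) ^+ 2 *+ 2)).

Let s20 : 0 < sigma * Num.sqrt 2.
Proof. by rewrite mulr_gt0// sqrtr_gt0. Qed.

Let mG : measurable_fun setT G.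
Proof.
apply: measurableT_comp => //.
by apply: measurable_funB; apply: measurable_funM => //; exact: measurable_funX.
Qed.

Let iG : P.-integrable setT (EFin \o G).
Proof.
apply/integrableP; split; first exact/measurable_EFinP.
under eq_integral do rewrite /= ger0_norm ?expR_ge0//.
by rewrite integral_gaussian_expsq// ltry.
Qed.

Lemma all_moments_gaussian : all_moments P X.
Proof.
split=> // k.
apply: (@integrable_le _ _ _ P _ (fun w => 1 + k`!%:R * 4 ^+ k * sigma ^+ (2 * k) * G w)).
- by apply: measurable_funX; apply: measurableT_comp.
- move=> w; rewrite normrX normr_id.
  apply: (@le_trans _ _ (1 + X w ^+ (2 * k))); last first.
    by rewrite lerD2l; exact: gaussian_expsq_le.
  rewrite mulnC exprM -[X in 1 + X]real_normK ?num_real// normrX.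
  set a := _ ^+ k; have : 0 <= (a - 1) ^+ 2 + a ^+ 2 + 1 by rewrite !addr_ge0// sqr_ge0.
  nra.
- apply: (@integrableD _ _ _ _ _ measurableT (fun=> 1%:E)
    (fun w => (k`!%:R * 4 ^+ k * sigma ^+ (2 * k))%:E * (G w)%:E)%E).
    exact: finite_measure_integrable_cst.
  exact: integrableZl.
Qed.

(** The factor [Num.sqrt 2] is the ratio [s / sigma]. What matters later is the power of [sigma],
    which gives moments of order [h ^+ k] for the steps of the chain. *)
Lemma mean_gaussian_even_le k :
  mean P (fun w => X w ^+ (2 * k)) <=
  k`!%:R * 4 ^+ k * Num.sqrt 2 * sigma ^+ (2 * k).
Proof.
apply: (@le_trans _ _ (\int[P]_w (k`!%:R * 4 ^+ k * sigma ^+ (2 * k) * G w))).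
  apply: le_Rintegral => //.
  - by apply: all_moments_integrable; apply: all_momentsX; exact: all_moments_gaussian.
  - under [X in integrable _ _ X]eq_fun do rewrite /= EFinM.
    exact: integrableZl.
  - by move=> w _; exact: gaussian_expsq_le.
rewrite RintegralZl// /Rintegral integral_gaussian_expsq//=.
rewrite [sigma * _]mulrC mulfK ?gt_eqF//.
by rewrite -[leRHS]mulrA [X in _ <= _ * X]mulrC mulrA.
Qed.

(** [X] and [- X] have the same law, so the mean is its own opposite. *)
Lemma mean_gaussian_odd n : odd n -> mean P (fun w => X w ^+ n) = 0.
Proof.
move=> on.
pose f (x : R) := (x ^+ n)%:E.
have mf : measurable_fun setT f by apply/measurable_EFinP; exact: exprn_measurable.
have mNX : measurable_fun setT (fun w => - X w) by exact: measurableT_comp.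
pose NX : {RV P >-> measurableTypeR R} := HB.pack (fun w => - X w) (@isMeasurableFun.Build _ _ _ (measurableTypeR R) _ mNX).
have iX := all_moments_integrable (all_momentsX n all_moments_gaussian).
have NE : (fun w => (- X w) ^+ n) = (fun w => -1 * X w ^+ n).
  by apply/funext => w; rewrite exprNn -signr_odd on expr1.
have iNX : P.-integrable setT (EFin \o (fun w => (- X w) ^+ n)).
  by rewrite NE; exact: (integrableZl _ _ iX).
have E : mean P (fun w => X w ^+ n) = mean P (fun w => (- X w) ^+ n).
  rewrite /mean /Rintegral; congr fine.
  have := @integral_distribution _ _ _ _ _ P X' f mf iX => /= <-.
  have := @integral_distribution _ _ _ _ _ P NX f mf iNX => /= <-.
  apply: eq_measure_integral => U mU _.
  rewrite /= /distribution /pushforward/= lawX//.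
  have -> : (fun w => - X w) @^-1` U = X @^-1` (-%R @^-1` U) by [].
  rewrite lawX ?normal_prob_oppr ?gt_eqF//.
  by rewrite -[_ @^-1` _]setTI; exact: oppr_measurable.
move: E; rewrite NE meanZ; last by apply: all_momentsX; exact: all_moments_gaussian.
lra.
Qed.

(* The integral of [integral_gaussian_expsq] equals [q] at [s = sigma * q]; bounding
   the exponential below by its tangent gives an inequality whose limit as [q]
   tends to 1, from either side, is the value of the second moment. *)
Lemma mean_gaussian_sqr : mean P (fun w => X w ^+ 2) = sigma ^+ 2.
Proof.
have aX2 : all_moments P (fun w => X w ^+ 2).
  by apply: all_momentsX; exact: all_moments_gaussian.
set m := mean P _; have m0 : 0 <= m by apply: mean_ge0 => w; exact: sqr_ge0.
have s2 : 0 < sigma ^+ 2 by rewrite exprn_gt0.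
have key q : 0 < q -> 2 * sigma ^+ 2 * q ^+ 2 * (1 - q) <= (1 - q) * (1 + q) * m.
  move=> q0; have sq0 : 0 < sigma * q by exact: mulr_gt0.
  pose c := (sigma ^+ 2 *+ 2)^-1 - ((sigma * q) ^+ 2 *+ 2)^-1.
  have : 1 + c * m <= sigma * q / sigma.
    rewrite -(mean_cst P 1) -meanZ// -meanD//; last 2 first.
    - exact: all_moments_cst.
    - by apply: all_momentsM => //; exact: all_moments_cst.
    pose F w := expR (X w ^+ 2 / (sigma ^+ 2 *+ 2) - X w ^+ 2 / ((sigma * q) ^+ 2 *+ 2)).
    have mF : measurable_fun setT F.
      apply: measurableT_comp => //.
      by apply: measurable_funB; apply: measurable_funM => //; exact: measurable_funX.
    have -> : sigma * q / sigma = \int[P]_w F w.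
      by rewrite /Rintegral integral_gaussian_expsq.
    apply: le_Rintegral => //.
    - apply: all_moments_integrable; apply: all_momentsD; first exact: all_moments_cst.
      by apply: all_momentsM => //; exact: all_moments_cst.
    - apply/integrableP; split; first exact/measurable_EFinP.
      under eq_integral do rewrite /= ger0_norm ?expR_ge0//.
      by rewrite integral_gaussian_expsq// ltry.
    - move=> w _; rewrite /F -mulrBr mulrC; exact: expR_ge1Dx.
  rewrite mulrAC divff ?gt_eqF// mul1r => h.
  (* Clearing denominators in [1 + c * m <= q] brings out the factor [1 - q], whose sign decides
     whether [m] is bounded from below or from above. *)
  have q2 : 0 < 2 * sigma ^+ 2 * q ^+ 2 by rewrite mulr_gt0 ?exprn_gt0// mulr_gt0.
  rewrite -(ler_pM2l q2) in h.
  have E : 2 * sigma ^+ 2 * q ^+ 2 * (1 + c * m) = 2 * sigma ^+ 2 * q ^+ 2 + (q ^+ 2 - 1) * m.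
    by rewrite /c; field; rewrite !gt_eqF.
  rewrite E in h; lra.
apply/eqP; rewrite eq_le; apply/andP; split; rewrite leNgt; apply/negP => hm.
(* For [e <= 1], [2 sigma^2 (1 + e)^2 <= 2 sigma^2 + 6 sigma^2 e <= sigma^2 + m < 2 m], against
   [key] at [q = 1 + e]. *)
- pose e := Num.min 1 ((m - sigma ^+ 2) / (6 * sigma ^+ 2)).
  have e0 : 0 < e by rewrite lt_min ltr01/= divr_gt0 ?subr_gt0// mulr_gt0.
  have e1 : e <= 1 by rewrite ge_min lexx.
  have e2 : e * (6 * sigma ^+ 2) <= m - sigma ^+ 2.
    by rewrite -ler_pdivlMr ?mulr_gt0// ge_min lexx orbT.
  have := key (1 + e) (addr_gt0 ltr01 e0).
  have -> : 1 - (1 + e) = - e by ring.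
  rewrite -subr_ge0 [X in 0 <= X](_ : _ = e * (2 * sigma ^+ 2 * (1 + e) ^+ 2 - (2 + e) * m)); last by ring.
  rewrite pmulr_rge0//.
  have : sigma ^+ 2 * e ^+ 2 <= sigma ^+ 2 * e by rewrite ler_pM2l// expr2 ler_piMr// ltW.
  nra.
(* Now [2 sigma^2 (1 - e)^2 >= 2 sigma^2 - 4 sigma^2 e >= sigma^2 + m > 2 m], against [key] at
   [q = 1 - e]; the bound 1/2 keeps [q] positive. *)
- pose e := Num.min (1 / 2) ((sigma ^+ 2 - m) / (4 * sigma ^+ 2)).
  have e0 : 0 < e by rewrite lt_min divr_gt0//= divr_gt0 ?subr_gt0// mulr_gt0.
  have e1 : e <= 1 / 2 by rewrite ge_min lexx.
  have e2 : e * (4 * sigma ^+ 2) <= sigma ^+ 2 - m.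
    by rewrite -ler_pdivlMr ?mulr_gt0// ge_min lexx orbT.
  have q0 : 0 < 1 - e by lra.
  have := key (1 - e) q0.
  have -> : 1 - (1 - e) = e by ring.
  rewrite -subr_ge0 [X in 0 <= X](_ : _ = e * ((2 - e) * m - 2 * sigma ^+ 2 * (1 - e) ^+ 2)); last by ring.
  rewrite pmulr_rge0//.
  have : 0 <= sigma ^+ 2 * e ^+ 2 by rewrite mulr_ge0 ?sqr_ge0.
  nra.
Qed.
End gaussian_moments.

(** * The chain on a grid *)

Section first_index.
Implicit Types n : nat -> nat.

(* When [n] counts the resets at grid times, this is the first grid point after
   the last reset before [j]. *)
Definition first_index n j := find (fun i => n i == n j) (iota 0 j).

Lemma first_index_le n j : (first_index n j <= j)%N.
Proof. by rewrite -[leqRHS](size_iota 0) find_size. Qed.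

(** Index [i] itself passes the test, so a longer search stops at the same place. Hence all indices
    with the same count share one start. *)
Lemma first_index_find n i m : (i < m)%N ->
  first_index n i = find (fun k => n k == n i) (iota 0 m).
Proof.
move=> im; rewrite /first_index -(subnKC im) -addn1 -addnA iotaD find_cat add0n.
case: ifPn => // /hasNfind ->; rewrite size_iota.
by rewrite add1n /= eqxx addn0.
Qed.

Lemma first_index_eqS n j : n j.+1 = n j -> first_index n j.+1 = first_index n j.
Proof. by move=> nj; rewrite (@first_index_find n j j.+1)// /first_index nj. Qed.

Lemma first_index_neqS n j : (forall i, (i <= j)%N -> (n i <= n j)%N) ->
  (n j < n j.+1)%N -> first_index n j.+1 = j.+1.
Proof.
move=> nd nj; rewrite /first_index hasNfind ?size_iota//.
apply/hasPn => i; rewrite mem_iota add0n ltnS => /nd nij.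
by rewrite neq_ltn (leq_ltn_trans nij nj).
Qed.

Lemma first_index_ext n n' j : (forall i, (i <= j)%N -> n i = n' i) ->
  first_index n j = first_index n' j.
Proof.
move=> nn'; rewrite /first_index; apply: eq_in_find => i.
by rewrite mem_iota add0n => ij; rewrite !nn'// ltnW.
Qed.

End first_index.

(** * Independence from product formulas on initial segments *)

Section joint_law.
Context (d : measure_display) (Omega : measurableType d) (R : realType)
  (P : probability Omega R) (Y : nat -> Omega -> R)
  (nu : nat -> set R -> \bar R).
Hypothesis nuT : forall k, nu k setT = 1%E.
Hypothesis jointY : forall m (U : nat -> set R), (forall k, measurable (U k)) ->
  P (\bigcap_(k in `I_m) Y k @^-1` U k) = (\prod_(k <- iota 0 m) nu k (U k))%E.

Lemma prod_restrict (F : nat -> \bar R) (s : seq nat) m :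
  uniq s -> (forall k, k \in s -> (k < m)%N) ->
  (\prod_(k <- iota 0 m) (if k \in s then F k else 1%E) = \prod_(k <- s) F k)%E.
Proof.
move=> us sm; rewrite -big_mkcond -big_filter; apply: perm_big.
apply: uniq_perm => //; first by rewrite filter_uniq// iota_uniq.
move=> k; rewrite mem_filter mem_iota add0n.
by case: (boolP (k \in s)) => //= ks; rewrite sm.
Qed.

(** Indices missing from [s] below its maximum are filled in with [setT], each contributing a factor
    1 by [nuT]. *)
Lemma joint_law_seq (s : seq nat) (U : nat -> set R) : uniq s ->
  (forall k, k \in s -> measurable (U k)) ->
  P (\bigcap_(k in [set` s]) Y k @^-1` U k) = (\prod_(k <- s) nu k (U k))%E.
Proof.
move=> us mU; pose m := (\max_(k <- s) k).+1.
have sm k : k \in s -> (k < m)%N by move=> ks; rewrite ltnS; exact: leq_bigmax_seq.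
pose U' k := if k \in s then U k else setT.
have mU' k : measurable (U' k) by rewrite /U'; case: ifPn => // /mU.
have := jointY m mU'.
rewrite (_ : \bigcap_(k in `I_m) _ = \bigcap_(k in [set` s]) Y k @^-1` U k).
  move=> ->; rewrite -(prod_restrict (fun k => nu k (U k)) us sm).
  by apply: eq_bigr => k _; rewrite /U'; case: ifPn.
apply/seteqP; split=> w h k /= ks; first by have := h k (sm _ ks); rewrite /U' ks.
by rewrite /U'; case: ifPn => // /h.
Qed.

Lemma joint_law_marginal k U : measurable U -> P (Y k @^-1` U) = nu k U.
Proof.
move=> mU; have := @joint_law_seq [:: k] (fun=> U) isT (fun _ _ => mU).
rewrite big_seq1 => <-; congr (P _); apply/seteqP; split => w.
  by move=> h i /=; rewrite inE => /eqP ->.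
by move=> /(_ k); apply; rewrite /= inE.
Qed.

Lemma joint_law_indep : mutually_independent P (fun k => sigma_rv (Y k)).
Proof.
move=> s A us sA.
have /choice[U UP] : forall k, exists V : set R,
    k \in s -> measurable V /\ A k = Y k @^-1` V.
  move=> k; case: (boolP (k \in s)) => [/sA[V mV <-]|_]; last by exists setT.
  by exists V => _; rewrite setTI.
rewrite (_ : \bigcap_(k in _) _ = \bigcap_(k in [set` s]) Y k @^-1` U k); last first.
  by apply: eq_bigcapr => k /= /UP[].
rewrite joint_law_seq//; last by move=> k /UP[].
rewrite big_seq [RHS]big_seq; apply: eq_bigr => k /UP[mU ->].
by rewrite joint_law_marginal.
Qed.

End joint_law.

Section grid.
Context (d : measure_display) (Omega : measurableType d) (R : realType)
  (P : probability Omega R) (r : R) (N : R -> {RV P >-> nat})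
  (B : nat -> R -> {RV P >-> R}) (h : R).
Hypothesis ppN : poisson_process r N.
Hypothesis bmB : forall k, standard_brownian_motion (B k).
Hypothesis indNB : mutually_independent P (fun i : option nat =>
  if i is Some k then sigma_process (B k : R -> Omega -> R)
  else sigma_process (N : R -> Omega -> nat)).
Hypothesis h0 : 0 < h.

Definition cnt (w : Omega) (i : nat) : nat := N (i%:R * h) w.

Lemma cnt_le w i j : (i <= j)%N -> (cnt w i <= cnt w j)%N.
Proof.
move=> ij; apply: (pp_nondecreasing ppN).
  by rewrite mulr_ge0// ltW.
by rewrite ler_pM2r// ler_nat.
Qed.

(** The start is that of the piece alive at [j], even when [i = j.+1]: a step prolongs the current
    piece whether or not a reset occurs during it, which keeps steps independent of survivals. *)
Definition age (n : nat -> nat) (j i : nat) : R := (i - first_index n j)%:R * h.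

Definition bm_incr (n : nat -> nat) (j : nat) (w : Omega) : R :=
  B (n j) (age n j j.+1) w - B (n j) (age n j j) w.

Definition position (j : nat) (w : Omega) : R :=
  B (cnt w j) (age (cnt w) j j) w.

Definition step (j : nat) (w : Omega) : R := bm_incr (cnt w) j w.

(** Written with an increment of [N], so that [pp_indep_incr] applies directly; [stayE] gives the
    comparison of counts. *)
Definition stay (j : nat) (w : Omega) : R :=
  ((N (j.+1%:R * h) w - N (j%:R * h) w)%N == 0)%:R.

Lemma stayE j w : stay j w = (cnt w j.+1 == cnt w j)%:R.
Proof.
rewrite /stay -/(cnt w j) -/(cnt w j.+1); congr (nat_of_bool _)%:R.
by rewrite subn_eq0 eqn_leq (cnt_le w (leqnSn j)) andbT.
Qed.

Lemma position0 w : position 0 w = 0.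
Proof. by rewrite /position /age sub0n mul0r; exact: (bm_start (bmB _)). Qed.

(** Without a reset the piece and its starting index persist and the step telescopes. After a reset
    [first_index] is [j.+1] itself, so the age is 0 and the fresh piece is at 0. *)
Lemma positionS j w : position j.+1 w = stay j w * (position j w + step j w).
Proof.
rewrite stayE; case: eqP => [e|/eqP ne].
  rewrite mul1r /position /step /bm_incr /age -e (first_index_eqS e) e.
  by rewrite addrC subrK.
rewrite mul0r /position /age first_index_neqS ?subnn ?mul0r.
- exact: (bm_start (bmB _)).
- by move=> i ij; exact: cnt_le.
- by rewrite ltn_neqAle eq_sym ne cnt_le.
Qed.

Lemma age_ge0 n j i : 0 <= age n j i.
Proof. by rewrite mulr_ge0// ltW. Qed.

Lemma bm_incr_ext n n' j w : (forall i, (i <= j)%N -> n i = n' i) ->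
  bm_incr n j w = bm_incr n' j w.
Proof.
by move=> nn; rewrite /bm_incr /age (first_index_ext nn) nn.
Qed.

Lemma measurable_bm_incr n j : measurable_fun setT (bm_incr n j).
Proof. exact: measurable_funB. Qed.

(* Conditionally on the counts at grid times, the steps are increments of fixed
   Brownian motions over fixed intervals; encoding the counts in a natural number
   reduces this conditioning to a countable sum. *)
Definition path_code (m : nat) (w : Omega) : nat :=
  pickle [seq cnt w i | i <- iota 0 m].

Lemma path_codeP m w w' : path_code m w = path_code m w' <->
  (forall i, (i < m)%N -> cnt w i = cnt w' i).
Proof.
split.
  move=> /(pcan_inj pickleK) e i im.
  have := congr1 (fun s => nth 0%N s i) e.
  by rewrite !(nth_map 0%N) ?size_iota// nth_iota// add0n.
move=> e; congr pickle; apply/eq_in_map => i; rewrite mem_iota add0n; exact: e.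
Qed.

Lemma path_code_fiber m w0 :
  path_code m @^-1` [set path_code m w0] =
  \bigcap_(i in `I_m) (N (i%:R * h) : Omega -> nat) @^-1` [set cnt w0 i].
Proof. by apply/seteqP; split=> w /= /path_codeP. Qed.

Lemma path_code_fiber0 m c :
  path_code m @^-1` [set c] = set0 \/
  exists w0, path_code m w0 = c.
Proof.
have [|/set0P[w0 /= <-]] := eqVneq (path_code m @^-1` [set c]) set0; first by left.
by right; exists w0.
Qed.

Lemma measurable_path_code m c : measurable (path_code m @^-1` [set c]).
Proof.
have [->//|[w0 <-]] := path_code_fiber0 m c.
rewrite path_code_fiber; apply: fin_bigcap_measurable; first exact: finite_II.
by move=> i _; rewrite -[_ @^-1` _]setTI; exact: measurable_funPT.
Qed.

Lemma path_code_cover m (A : set Omega) :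
  A = \bigcup_c (A `&` path_code m @^-1` [set c]).
Proof.
apply/seteqP; split=> [w Aw|w [c _ []]//].
by exists (path_code m w).
Qed.

Lemma path_code_triv m (A : set Omega) :
  trivIset setT (fun c => A `&` path_code m @^-1` [set c]).
Proof.
apply/trivIsetP => c c' _ _ cc'; rewrite -subset0 => w [[_ /= e1] [_ /= e2]].
by move: cc'; rewrite -e1 e2 eqxx.
Qed.

Lemma measurable_step j : measurable_fun setT (step j).
Proof.
move=> _ U mU; rewrite setTI (path_code_cover j.+1 (step j @^-1` U)).
apply: bigcup_measurable => c _.
have [->|[w0 <-]] := path_code_fiber0 j.+1 c; first by rewrite setI0.
rewrite (_ : _ `&` _ = bm_incr (cnt w0) j @^-1` U `&`
   path_code j.+1 @^-1` [set path_code j.+1 w0]).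
  apply: measurableI; last exact: measurable_path_code.
  by rewrite -[_ @^-1` _]setTI; exact: measurable_bm_incr.
by apply/seteqP; split=> w [] /= uw /[dup] cw /path_codeP e;
  split=> //; move: uw; rewrite /step (@bm_incr_ext (cnt w) (cnt w0)).
Qed.

Lemma measurable_stay j : measurable_fun setT (stay j).
Proof.
apply: (@measurableT_comp _ _ _ _ _ _ (fun k : nat => (k == 0%N)%:R : R) _ (fun w => N (j.+1%:R * h) w - N (j%:R * h) w)%N) => //.
exact: measurable_fun_subn.
Qed.

Lemma bm_incr_law n j (U : set R) : measurable U ->
  P (bm_incr n j @^-1` U) = normal_prob 0 (Num.sqrt h) U.
Proof.
move=> mU; have le := first_index_le n j.
have e : age n j j.+1 - age n j j = h.
  by rewrite /age subSn// -natr1 mulrDl mul1r addrAC subrr add0r.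
rewrite -e; apply: (bm_normal_incr (bmB (n j))) => //; first exact: age_ge0.
by rewrite -subr_gt0 e.
Qed.

Lemma bm_incr_indep n m k (U : nat -> set R) : (forall i, measurable (U i)) ->
  P (\bigcap_(i in [set` [seq i <- iota 0 m | n i == k]]) bm_incr n i @^-1` U i) =
  (\prod_(i <- iota 0 m | n i == k) normal_prob 0 (Num.sqrt h) (U i))%E.
Proof.
move=> mU; pose st := find (fun i => n i == k) (iota 0 m).
(* Truncated subtraction freezes the times at 0 before the start [st] of piece [k], so that the
   sequence is nondecreasing from index 0 on. From [st] on, the steps of this piece are increments
   over consecutive intervals. *)
pose t i : R := (i - st)%:R * h.
have t0 : 0 <= t 0%N by rewrite /t sub0n mul0r.
have tS i : t i <= t i.+1 by rewrite ler_pM2r// ler_nat leq_sub2r.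
have stE i : i \in [seq i <- iota 0 m | n i == k] -> bm_incr n i =
    (fun w => B k (t i.+1) w - B k (t i) w).
  rewrite mem_filter mem_iota add0n => /andP[/eqP nik /= im].
  by rewrite /bm_incr /age (first_index_find n im) nik.
rewrite (@bm_indep_incr _ _ _ _ _ (bmB k) t t0 tS
   [seq i <- iota 0 m | n i == k] (fun i => bm_incr n i @^-1` U i)).
- by rewrite big_filter; apply: eq_bigr => i _; exact: bm_incr_law.
- by rewrite filter_uniq// iota_uniq.
- by move=> i /stE ->; exists (U i) => //; rewrite setTI.
Qed.

Lemma bm_incr_sigma n j (U : set R) : measurable U ->
  sigma_process (B (n j) : R -> Omega -> R) (bm_incr n j @^-1` U).
Proof.
move=> mU.
pose G := \bigcup_(t in `[(0 : R), +oo[) sigma_rv (B (n j) t : Omega -> R).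
have mB t : 0 <= t -> measurable_fun (setT : set (g_sigma_algebraType G)) (B (n j) t).
  move=> t0 _ V mV; apply: sub_sigma_algebra; exists t; first by rewrite /= in_itv/= t0.
  by exists V.
have := measurable_funB (mB _ (age_ge0 n j j.+1)) (mB _ (age_ge0 n j j)).
by move=> /(_ measurableT U mU); rewrite setTI.
Qed.

Lemma path_code_sigma m w0 :
  sigma_process (N : R -> Omega -> nat) (path_code m @^-1` [set path_code m w0]).
Proof.
pose G := \bigcup_(t in `[(0 : R), +oo[) sigma_rv (N t : Omega -> nat).
rewrite path_code_fiber.
apply: (@fin_bigcap_measurable _ (g_sigma_algebraType G)); first exact: finite_II.
move=> i _; apply: sub_sigma_algebra; exists (i%:R * h).
  by rewrite /= in_itv/= mulr_ge0// ltW.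
by exists [set cnt w0 i] => //; rewrite setTI.
Qed.

(** On the fibre the counts are those of [w0], so every step is an increment of a known Brownian
    motion. Grouping the steps by piece, independence of [N] and the [B k] separates the groups, and
    [bm_incr_indep] separates the steps within a group. *)
Lemma path_step_indep m w0 (U : nat -> set R) : (forall i, measurable (U i)) ->
  P (path_code m.+1 @^-1` [set path_code m.+1 w0] `&`
     \bigcap_(i in `I_m) step i @^-1` U i) =
  (\prod_(i <- iota 0 m) normal_prob 0 (Num.sqrt h) (U i) *
   P (path_code m.+1 @^-1` [set path_code m.+1 w0]))%E.
Proof.
move=> mU; set C := path_code _ @^-1` _; set n := cnt w0.
pose A k := \bigcap_(i in [set` [seq i <- iota 0 m | n i == k]]) bm_incr n i @^-1` U i.
pose A' o := if o is Some k then A k else C.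
(* All pieces up to the last count are listed; one without grid steps gives an empty intersection
   and an empty product. *)
pose s := None :: map Some (iota 0 (n m).+1).
have us : uniq s.
  rewrite cons_uniq map_inj_uniq ?iota_uniq ?andbT; last by move=> ? ? [].
  by apply/negP => /mapP[].
have nm i : (i < m)%N -> n i \in iota 0 (n m).+1.
  by move=> im; rewrite mem_iota add0n ltnS cnt_le// ltnW.
have := indNB us (A := A').
rewrite (_ : \bigcap_(o in [set` s]) A' o = C `&` \bigcap_(i in `I_m) step i @^-1` U i); last first.
  apply/seteqP; split=> w.
    move=> hw; have Cw : C w by exact: (hw None).
    split=> // i im.
    have sn : Some (n i) \in s by rewrite in_cons map_f ?nm ?orbT.
    have /(_ i) := hw (Some (n i)) sn.
    rewrite /= mem_filter eqxx mem_iota add0n im => /(_ isT).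
    rewrite /step (@bm_incr_ext (cnt w) n)// => j ji.
    by move/path_codeP : Cw; apply; rewrite ltnS (leq_trans ji)// ltnW.
  move=> [Cw Sw] [k|] //= _ i /=; rewrite mem_filter mem_iota add0n => /andP[/eqP nik /= im].
  have := Sw i im; rewrite /step /= (@bm_incr_ext (cnt w) n)// => j ji.
  by move/path_codeP : Cw; apply; rewrite ltnS (leq_trans ji)// ltnW.
move=> ->; last first.
  move=> [k|] _ /=; last exact: path_code_sigma.
  pose G := \bigcup_(t in `[(0 : R), +oo[) sigma_rv (B k t : Omega -> R).
  apply: (@fin_bigcap_measurable _ (g_sigma_algebraType G)); first exact: finite_seq.
  move=> i /=; rewrite mem_filter => /andP[/eqP nik _].
  by have := @bm_incr_sigma n i _ (mU i); rewrite nik.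
rewrite big_cons big_map /= muleC; congr (_ * _)%E.
under eq_bigr do rewrite bm_incr_indep//.
(* Each [i < m] belongs to exactly one group, that of its count [n i]. *)
rewrite (exchange_big_dep xpredT)//= big_seq [RHS]big_seq; apply: eq_bigr => i.
rewrite mem_iota add0n => /nm nim.
under eq_bigl do rewrite eq_sym.
by rewrite -big_filter (filter_pred1_uniq (iota_uniq _ _) nim) big_seq1.
Qed.

(** The first [m] survivals are determined by the counts at times 0 to [m], that is by
    [path_code m.+1]. Hence each fibre lies inside the survival event or misses it, and
    [path_step_indep] is summed over the fibres inside. *)
Lemma step_stay_joint m (U E : nat -> set R) :
  (forall i, measurable (U i)) -> (forall i, measurable (E i)) ->
  P (\bigcap_(i in `I_m) step i @^-1` U i `&`
     \bigcap_(i in `I_m) stay i @^-1` E i) =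
  (\prod_(i <- iota 0 m) normal_prob 0 (Num.sqrt h) (U i) *
   P (\bigcap_(i in `I_m) stay i @^-1` E i))%E.
Proof.
move=> mU mE; set G := \bigcap_(i in _) step i @^-1` _.
set S := \bigcap_(i in _) stay i @^-1` _.
have mG : measurable G.
  apply: fin_bigcap_measurable; first exact: finite_II.
  by move=> i _; rewrite -[_ @^-1` _]setTI; exact: measurable_step.
have mS : measurable S.
  apply: fin_bigcap_measurable; first exact: finite_II.
  by move=> i _; rewrite -[_ @^-1` _]setTI; exact: measurable_stay.
set g := (X in (X * _)%E).
have gfin : g \is a fin_num.
  by rewrite /g; elim/big_ind : _ => // [x y|i _]; [exact: fin_numM|apply: (fin_num_measure (normal_prob 0 (Num.sqrt h))); exact: mU].
rewrite [in LHS](path_code_cover m.+1 (G `&` S)) [in RHS](path_code_cover m.+1 S).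
rewrite !measure_bigcup//; try exact: path_code_triv.
- rewrite -(fineK gfin) -nneseriesZl// (fineK gfin).
  apply: eq_eseriesr => c _.
  have [->|[w0 <-]] := path_code_fiber0 m.+1 c; first by rewrite !setI0 measure0 mule0.
  set C := path_code _ @^-1` _.
  have CS w : C w -> S w <-> S w0.
    move=> Cw; have e i : (i < m)%N -> stay i w = stay i w0.
      move=> im; rewrite !stayE; move/path_codeP : Cw => e.
      by rewrite !e// ltnS// ltnW.
    by split=> hS i im; have := hS i im; rewrite /= e.
  have [Sw0|Sw0] := pselect (S w0).
    have -> : S `&` C = C by apply/seteqP; split=> [w []//|w Cw]; split=> //; apply/CS.
    rewrite -setIA (_ : S `&` C = C); last first.
      by apply/seteqP; split=> [w []//|w Cw]; split=> //; apply/CS.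
    by rewrite setIC; exact: path_step_indep.
  have -> : S `&` C = set0.
    by rewrite -subset0 => w [Sw Cw]; apply: Sw0; exact: (proj1 (CS w Cw)).
  rewrite -setIA (_ : S `&` C = set0) ?setI0 ?measure0 ?mule0//.
  by rewrite -subset0 => w [Sw Cw]; apply: Sw0; exact: (proj1 (CS w Cw)).
- by move=> c _; apply: measurableI => //; exact: measurable_path_code.
- by move=> c _; apply: measurableI; [exact: measurableI|exact: measurable_path_code].
Qed.

Lemma stay_indep m (E : nat -> set R) : (forall i, measurable (E i)) ->
  P (\bigcap_(i in `I_m) stay i @^-1` E i) =
  (\prod_(i <- iota 0 m) P (stay i @^-1` E i))%E.
Proof.
move=> mE; pose t i : R := i%:R * h.
have tS i : t i <= t i.+1 by rewrite ler_pM2r// ler_nat.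
have t0 : 0 <= t 0%N by rewrite /t mul0r.
rewrite -(@pp_indep_incr _ _ _ _ _ _ ppN t t0 tS (iota 0 m) (fun i => stay i @^-1` E i)).
- by congr (P _); apply: eq_bigcapl; split=> i /=; rewrite mem_iota add0n.
- exact: iota_uniq.
- by move=> i _; exists [set k | E i (k == 0%N)%:R] => //; rewrite setTI.
Qed.

(* The steps and the survivals in their order of occurrence, so that a single
   family of independent variables carries the whole past of the chain. *)
Definition noise (k : nat) : Omega -> R :=
  if odd k then stay k./2 else step k./2.

Definition noise_law (k : nat) (U : set R) : \bar R :=
  if odd k then P (stay k./2 @^-1` U) else normal_prob 0 (Num.sqrt h) U.

Lemma noise_even i : noise i.*2 = step i.
Proof. by rewrite /noise odd_double doubleK. Qed.

Lemma noise_odd i : noise i.*2.+1 = stay i.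
Proof. by rewrite /noise /= odd_double uphalf_double. Qed.

Lemma measurable_noise k : measurable_fun setT (noise k).
Proof. by rewrite /noise; case: ifP => _; [exact: measurable_stay|exact: measurable_step]. Qed.

Lemma noise_law_setT k : noise_law k setT = 1%E.
Proof.
rewrite /noise_law; case: ifP => _; first exact: probability_setT.
exact: (@probability_setT _ _ _ (normal_prob 0 (Num.sqrt h))).
Qed.

Lemma prod_iota_double (F : nat -> \bar R) m :
  (\prod_(k <- iota 0 m.*2) F k =
   \prod_(i <- iota 0 m) F i.*2 * \prod_(i <- iota 0 m) F i.*2.+1)%E.
Proof.
rewrite -big_split/=; elim: m => [|m ih]; first by rewrite !big_nil.
rewrite doubleS -[m.+1]addn1 -[m.*2.+2]addn2 !iotaD !big_cat ih; congr (_ * _)%E.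
by rewrite /= !add0n !big_cons !big_nil !mule1.
Qed.

Lemma noise_joint m (U : nat -> set R) : (forall k, measurable (U k)) ->
  P (\bigcap_(k in `I_m) noise k @^-1` U k) =
  (\prod_(k <- iota 0 m) noise_law k (U k))%E.
Proof.
(* The first [m] noises may end with an unpaired step; extending to [m.*2] with [setT] gives
   complete step-survival pairs. *)
move=> mU; pose U' k := if (k < m)%N then U k else setT.
have mU' k : measurable (U' k) by rewrite /U'; case: ifP.
rewrite (_ : \bigcap_(k in _) _ =
    \bigcap_(i in `I_m) step i @^-1` U' i.*2 `&`
    \bigcap_(i in `I_m) stay i @^-1` U' i.*2.+1); last first.
  apply/seteqP; split=> w /=.
    move=> hw; split=> i im /=; rewrite /U'; case: ifP => // lt;
      by have := hw _ lt; rewrite /= ?noise_even ?noise_odd.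
  move=> [hstep hstay] k /= km; have k2 : (k./2 < m)%N by lia.
  have := hstep _ k2; have := hstay _ k2; have := odd_double_half k.
  rewrite /noise /U' /=; case: (odd k) => /= kE.
    by rewrite [in X in X -> _](_ : k./2.*2.+1 = k)// km.
  by rewrite [in X in _ -> X -> _](_ : k./2.*2 = k)// km.
rewrite (@step_stay_joint m (fun i => U' i.*2) (fun i => U' i.*2.+1))//.
rewrite (@stay_indep m (fun i => U' i.*2.+1))//.
transitivity (\prod_(k <- iota 0 m.*2) noise_law k (U' k))%E.
  rewrite prod_iota_double; congr (_ * _)%E; apply: eq_bigr => i _.
    by rewrite /noise_law odd_double.
  by rewrite /noise_law /= odd_double uphalf_double.
rewrite -addnn iotaD big_cat/= [X in (_ * X)%E]big_seq.
rewrite [X in (_ * X)%E]big1 ?mule1; last first.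
  move=> k; rewrite mem_iota add0n => /andP[mk _].
  by rewrite /U' ltnNge mk /= noise_law_setT.
rewrite big_seq [RHS]big_seq; apply: eq_bigr => k.
by rewrite mem_iota add0n /U' => /= ->.
Qed.

Lemma noise_indep : mutually_independent P (fun k => sigma_rv (noise k)).
Proof. exact: (joint_law_indep noise_law_setT noise_joint). Qed.

Lemma step_law j (U : set R) : measurable U ->
  P (step j @^-1` U) = normal_prob 0 (Num.sqrt h) U.
Proof.
move=> mU; have := joint_law_marginal noise_law_setT noise_joint j.*2 mU.
by rewrite noise_even /noise_law odd_double.
Qed.

Lemma stay_sqr j w : stay j w ^+ 2 = stay j w.
Proof. by rewrite /stay; case: eqP => _; rewrite ?expr0n ?expr1n. Qed.

Lemma stay_norm_le1 j w : `|stay j w| <= 1.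
Proof. by rewrite /stay; case: eqP => _; rewrite ?normr0 ?normr1. Qed.

Lemma mean_stay j : 0 < r -> mean P (stay j) = expR (- (r * h)).
Proof.
move=> r0; pose A := [set w | (N (j.+1%:R * h) w - N (j%:R * h) w)%N = 0%N].
have mA : measurable A.
  rewrite (_ : A = stay j @^-1` [set 1]).
    by rewrite -[_ @^-1` _]setTI; exact: measurable_stay.
  apply/seteqP; split=> w; rewrite /A /stay /=; first by move=> ->.
  by case: eqP => // _ /eqP; rewrite eq_sym oner_eq0.
have -> : stay j = \1_A.
  apply/funext => w; rewrite indicE /stay; congr (nat_of_bool _)%:R.
  by apply/eqP/idP; rewrite inE.
rewrite /mean /Rintegral integral_indic// setIT.
have PA : P A = (poisson_pmf (r * (j.+1%:R * h - j%:R * h)) 0)%:E.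
  apply: (pp_poisson_incr ppN); first by rewrite mulr_ge0// ltW.
  by rewrite ltr_pM2r// ltr_nat.
transitivity (fine (P A)) => //; rewrite PA /=.
rewrite -natr1 mulrDl mul1r addrAC subrr add0r /poisson_pmf mulr_gt0//.
by rewrite expr0 fact0 invr1 !mul1r.
Qed.

End grid.

(** * Moments on the grid *)

Section grid_moments.
Context (d : measure_display) (Omega : measurableType d) (R : realType)
  (P : probability Omega R) (r : R) (N : R -> {RV P >-> nat})
  (B : nat -> R -> {RV P >-> R}) (h : R).
Hypothesis r0 : 0 < r.
Hypothesis ppN : poisson_process r N.
Hypothesis bmB : forall k, standard_brownian_motion (B k).
Hypothesis indNB : mutually_independent P (fun i : option nat =>
  if i is Some k then sigma_process (B k : R -> Omega -> R)
  else sigma_process (N : R -> Omega -> nat)).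
Hypothesis h0 : 0 < h.

Local Notation position := (position N B h).
Local Notation step := (step N B h).
Local Notation stay := (stay N h).
Local Notation noise := (noise N B h).
Local Notation past := (past_measurable noise).

Definition riemann_sum (j : nat) (w : Omega) : R :=
  \sum_(i < j) h * position i w.

Lemma riemann_sumS j w :
  riemann_sum j.+1 w = riemann_sum j w + h * position j w.
Proof. by rewrite /riemann_sum big_ord_recr. Qed.

Lemma all_moments_step j : all_moments P (step j).
Proof.
apply: (@all_moments_gaussian _ _ _ _ (Num.sqrt h)); first by rewrite sqrtr_gt0.
  exact: measurable_step.
by move=> U mU; exact: (step_law ppN bmB indNB h0).
Qed.

Lemma all_moments_stay j : all_moments P (stay j).
Proof.
apply: (@all_moments_bounded _ _ _ _ 1); first exact: measurable_stay.
exact: stay_norm_le1.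
Qed.

(** The first [j] steps and survivals are the first [j.*2] noises, so the next step (noise [j.*2])
    and survival (noise [j.*2.+1]) are both outside this past. *)
Lemma past_position j : past j.*2 (position j).
Proof.
elim: j => [|j ih].
  rewrite (_ : position 0 = fun=> 0); first exact: past_measurable_cst.
  by apply/funext => w; exact: position0.
rewrite (_ : position j.+1 =
    fun w => noise j.*2.+1 w * (position j w + noise j.*2 w)).
  apply: past_measurableM; first exact: past_measurable_coord.
  apply: past_measurableD; last exact: past_measurable_coord.
  by apply: past_measurableS ih; rewrite doubleS ltnW.
by apply/funext => w; rewrite noise_odd noise_even (positionS ppN bmB h0).
Qed.

Lemma past_riemann_sum j : past j.*2 (riemann_sum j).
Proof.
elim: j => [|j ih].
  rewrite (_ : riemann_sum 0 = fun=> 0); first exact: past_measurable_cst.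
  by apply/funext => w; rewrite /riemann_sum big_ord0.
rewrite (_ : riemann_sum j.+1 = fun w => riemann_sum j w + h * position j w).
  have le : (j.*2 <= j.+1.*2)%N by rewrite leq_double.
  apply: past_measurableD; first exact: past_measurableS ih.
  apply: past_measurableM; first exact: past_measurable_cst.
  exact: (past_measurableS le (@past_position j)).
by apply/funext => w; rewrite riemann_sumS.
Qed.

Lemma all_moments_position j : all_moments P (position j).
Proof.
elim: j => [|j ih].
  rewrite (_ : position 0 = fun=> 0); first exact: all_moments_cst.
  by apply/funext => w; exact: position0.
rewrite (_ : position j.+1 = fun w => stay j w * (position j w + step j w)).
  apply: all_momentsM; first exact: all_moments_stay.
  by apply: all_momentsD => //; exact: all_moments_step.
by apply/funext => w; rewrite (positionS ppN bmB h0).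
Qed.

Lemma all_moments_riemann_sum j : all_moments P (riemann_sum j).
Proof.
elim: j => [|j ih].
  rewrite (_ : riemann_sum 0 = fun=> 0); first exact: all_moments_cst.
  by apply/funext => w; rewrite /riemann_sum big_ord0.
rewrite (_ : riemann_sum j.+1 = fun w => riemann_sum j w + h * position j w).
  apply: all_momentsD => //; apply: all_momentsM; first exact: all_moments_cst.
  exact: all_moments_position.
by apply/funext => w; rewrite riemann_sumS.
Qed.

Definition mixed_moment (a b j : nat) : R :=
  mean P (fun w => riemann_sum j w ^+ a * position j w ^+ b).

Lemma all_moments_mixed a b j :
  all_moments P (fun w => riemann_sum j w ^+ a * position j w ^+ b).
Proof.
by apply: all_momentsM; apply: all_momentsX;
  [exact: all_moments_riemann_sum|exact: all_moments_position].
Qed.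

Lemma past_mixed a b j :
  past j.*2 (fun w => riemann_sum j w ^+ a * position j w ^+ b).
Proof.
by apply: past_measurableM; apply: past_measurableX;
  [exact: past_riemann_sum|exact: past_position].
Qed.

Definition step_moment (l j : nat) : R := mean P (fun w => step j w ^+ l).

(** The noises are peeled off in reverse order: first the survival, then the step. *)
Lemma mean_noise_factor j l Z : past j.*2 Z -> all_moments P Z ->
  mean P (fun w => Z w * step j w ^+ l * stay j w) =
  expR (- (r * h)) * (mean P Z * step_moment l j).
Proof.
move=> pZ aZ.
have mN k : measurable_fun setT (noise k) by exact: measurable_noise.
have ind := noise_indep ppN bmB indNB h0.
have aS : all_moments P (fun w => step j w ^+ l).
  by apply: all_momentsX; exact: all_moments_step.
have e1 := @mean_past_indep _ _ _ _ _ mN ind j.*2.+1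
   (fun w => Z w * step j w ^+ l) id.
rewrite noise_odd in e1; rewrite e1//; last 3 first.
- apply: past_measurableM; first exact: past_measurableS pZ.
  by rewrite -(noise_even N B h); apply: past_measurableX; exact: past_measurable_coord.
- exact: all_momentsM.
- exact: all_moments_stay.
rewrite (@mean_stay _ _ _ _ r)// mulrC; congr (_ * _).
have e2 := @mean_past_indep _ _ _ _ _ mN ind j.*2 Z (fun x => x ^+ l).
by rewrite noise_even in e2; rewrite e2.
Qed.

(** Separate from [b > 0] because the new sum does not involve the survival of the current step, so
    no factor [expR (- (r * h))] appears. *)
Lemma mixed_moment0S a j : mixed_moment a 0 j.+1 =
  \sum_(i < a.+1) 'C(a, i)%:R * h ^+ i * mixed_moment (a - i) i j.
Proof.
rewrite /mixed_moment.
under [in LHS]eq_fun do rewrite expr0 mulr1 riemann_sumS exprDn.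
rewrite mean_sum; last first.
  move=> i; under eq_fun do rewrite -mulr_natl; apply: all_momentsM.
    exact: all_moments_cst.
  under eq_fun do rewrite exprMn mulrCA.
  by apply: all_momentsM; [exact: all_moments_cst|exact: all_moments_mixed].
apply: eq_bigr => i _; rewrite -meanZ; last exact: all_moments_mixed.
by congr (mean P _); apply/funext => w; rewrite -mulr_natl exprMn; ring.
Qed.

Lemma mixed_momentS a b j : mixed_moment a b.+1 j.+1 =
  expR (- (r * h)) * \sum_(i < a.+1) \sum_(l < b.+2)
    'C(a, i)%:R * 'C(b.+1, l)%:R * h ^+ i * step_moment l j *
    mixed_moment (a - i) (i + (b.+1 - l)) j.
Proof.
pose F (i l : nat) (w : Omega) : R := ('C(a, i)%:R * 'C(b.+1, l)%:R * h ^+ i) *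
  ((riemann_sum j w ^+ (a - i) * position j w ^+ (i + (b.+1 - l))) *
   step j w ^+ l * stay j w).
have aF i l : all_moments P (F i l).
  apply: all_momentsM; first exact: all_moments_cst.
  apply: all_momentsM; last exact: all_moments_stay.
  by apply: all_momentsM; [exact: all_moments_mixed|apply: all_momentsX; exact: all_moments_step].
rewrite [LHS](_ : _ = mean P (fun w => \sum_(i < a.+1) \sum_(l < b.+2) F i l w)).
  rewrite mean_sum; last by move=> i; exact: all_moments_sum.
  rewrite mulr_sumr; apply: eq_bigr => i _; rewrite mean_sum; last by move=> l; exact: aF.
  rewrite mulr_sumr; apply: eq_bigr => l _; rewrite meanZ; last first.
    apply: all_momentsM; last exact: all_moments_stay.
    by apply: all_momentsM; [exact: all_moments_mixed|apply: all_momentsX; exact: all_moments_step].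
  rewrite mean_noise_factor; [|exact: past_mixed|exact: all_moments_mixed].
  by rewrite /mixed_moment; ring.
congr (mean P _); apply/funext => w.
have stX : stay j w ^+ b.+1 = stay j w.
  elim: b {F aF} => [|b ih]; first by rewrite expr1.
  by rewrite exprS ih -expr2 stay_sqr.
rewrite riemann_sumS (positionS ppN bmB h0) exprMn stX !exprDn mulr_suml.
apply: eq_bigr => i _; rewrite mulr_sumr mulr_sumr; apply: eq_bigr => l _.
rewrite /F -(mulr_natl _ 'C(a, i)) -(mulr_natl _ 'C(b.+1, l)) exprMn exprD; ring.
Qed.

Lemma step_moment_odd l j : odd l -> step_moment l j = 0.
Proof.
move=> ol; apply: (@mean_gaussian_odd _ _ _ _ (Num.sqrt h)) => //.
- by rewrite sqrtr_gt0.
- exact: measurable_step.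
- by move=> U mU; exact: (step_law ppN bmB indNB h0).
Qed.

Lemma step_moment0 j : step_moment 0 j = 1.
Proof. by rewrite /step_moment; under eq_fun do rewrite expr0; exact: mean_cst. Qed.

Lemma step_moment2 j : step_moment 2 j = h.
Proof.
rewrite /step_moment (@mean_gaussian_sqr _ _ _ _ (Num.sqrt h)).
- by rewrite sqr_sqrtr// ltW.
- by rewrite sqrtr_gt0.
- exact: measurable_step.
- by move=> U mU; exact: (step_law ppN bmB indNB h0).
Qed.

Lemma step_moment_even_ge0 k j : 0 <= step_moment (2 * k) j.
Proof. by apply: mean_ge0 => w; rewrite exprM exprn_ge0// sqr_ge0. Qed.

Lemma step_moment_even_le k j :
  step_moment (2 * k) j <= k`!%:R * 4 ^+ k * Num.sqrt 2 * h ^+ k.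
Proof.
have -> : h ^+ k = Num.sqrt h ^+ (2 * k) by rewrite exprM sqr_sqrtr ?ltW.
apply: mean_gaussian_even_le.
- by rewrite sqrtr_gt0.
- exact: measurable_step.
- by move=> U mU; exact: (step_law ppN bmB indNB h0).
Qed.

Lemma mixed_moment_init a b : mixed_moment a b 0 = 0 ^+ a * 0 ^+ b.
Proof.
rewrite /mixed_moment -[RHS](mean_cst P); congr (mean P _); apply/funext => w.
by rewrite /riemann_sum big_ord0 (position0 N h bmB).
Qed.

(** The recursion lowers the total degree by the exponent [l] of the step only. Odd [l] has zero
    moment, so the parity of [a + b] is preserved back to time 0, where all moments of positive
    degree vanish. *)
Lemma mixed_moment_odd a b j : odd (a + b) -> mixed_moment a b j = 0.
Proof.
elim: j a b => [|j ih] a b ab.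
  rewrite mixed_moment_init; case: a ab => [|a]; case: b => [|b] //= _;
    by rewrite ?expr0n ?mul0r ?mulr0.
case: b ab => [|b] ab.
  rewrite mixed_moment0S big1// => i _; rewrite ih ?mulr0//.
  by rewrite subnK; [move: ab; rewrite addn0|rewrite leq_ord].
rewrite mixed_momentS big1 ?mulr0// => i _; rewrite big1// => l _.
have [ol|el] := boolP (odd l); first by rewrite step_moment_odd// mulr0 mul0r.
rewrite ih ?mulr0//.
have -> : (a - i + (i + (b.+1 - l)) = a + b.+1 - l)%N.
  by have := ltn_ord i; have := ltn_ord l; rewrite !ltnS; lia.
by rewrite oddB ?ab ?(negbTE el)//; have := ltn_ord l; rewrite ltnS; lia.
Qed.

Local Notation q := (expR (- (r * h))).

Lemma mixed_moment00 j : mixed_moment 0 0 j = 1.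
Proof.
rewrite /mixed_moment -[RHS](mean_cst P); congr (mean P _).
by apply/funext => w; rewrite !expr0 mulr1.
Qed.

Let bin42 : 'C(4, 2) = 6%N. Proof. by []. Qed.
Let bin43 : 'C(4, 3) = 4%N. Proof. by []. Qed.
Let bin32 : 'C(3, 2) = 3%N. Proof. by []. Qed.

Lemma mixed_moment_rec20 j : mixed_moment 2 0 j.+1 =
  mixed_moment 2 0 j + 2 * h * mixed_moment 1 1 j + h ^+ 2 * mixed_moment 0 2 j.
Proof.
rewrite mixed_moment0S !big_ord_recl big_ord0 /= /bump /=.
rewrite !(addSn, add0n, subSS, subn0, subnn, bin0, bin1, binn, bin42, bin43, bin32); ring.
Qed.

Lemma mixed_moment_rec11 j : mixed_moment 1 1 j.+1 =
  q * (mixed_moment 1 1 j + h * mixed_moment 0 2 j).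
Proof.
rewrite mixed_momentS !big_ord_recl !big_ord0 /= /bump /=.
rewrite !(addSn, add0n, addn0, subSS, subn0, subnn, bin0, bin1, binn, bin42, bin43, bin32).
rewrite !(step_moment0, step_moment2, @step_moment_odd 1 j isT, @step_moment_odd 3 j isT); ring.
Qed.

Lemma mixed_moment_rec02 j : mixed_moment 0 2 j.+1 =
  q * (mixed_moment 0 2 j + h * mixed_moment 0 0 j).
Proof.
rewrite mixed_momentS !big_ord_recl !big_ord0 /= /bump /=.
rewrite !(addSn, add0n, addn0, subSS, subn0, subnn, bin0, bin1, binn, bin42, bin43, bin32).
rewrite !(step_moment0, step_moment2, @step_moment_odd 1 j isT, @step_moment_odd 3 j isT); ring.
Qed.

Lemma mixed_moment_rec40 j : mixed_moment 4 0 j.+1 =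
  mixed_moment 4 0 j + 4 * h * mixed_moment 3 1 j + 6 * h ^+ 2 * mixed_moment 2 2 j +
  4 * h ^+ 3 * mixed_moment 1 3 j + h ^+ 4 * mixed_moment 0 4 j.
Proof.
rewrite mixed_moment0S !big_ord_recl big_ord0 /= /bump /=.
rewrite !(addSn, add0n, subSS, subn0, subnn, bin0, bin1, binn, bin42, bin43, bin32); ring.
Qed.

Lemma mixed_moment_rec31 j : mixed_moment 3 1 j.+1 =
  q * (mixed_moment 3 1 j + 3 * h * mixed_moment 2 2 j + 3 * h ^+ 2 * mixed_moment 1 3 j +
  h ^+ 3 * mixed_moment 0 4 j).
Proof.
rewrite mixed_momentS !big_ord_recl !big_ord0 /= /bump /=.
rewrite !(addSn, add0n, addn0, subSS, subn0, subnn, bin0, bin1, binn, bin42, bin43, bin32).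
rewrite !(step_moment0, step_moment2, @step_moment_odd 1 j isT, @step_moment_odd 3 j isT); ring.
Qed.

Lemma mixed_moment_rec22 j : mixed_moment 2 2 j.+1 =
  q * (mixed_moment 2 2 j + 2 * h * mixed_moment 1 3 j + h ^+ 2 * mixed_moment 0 4 j +
  h * (mixed_moment 2 0 j + 2 * h * mixed_moment 1 1 j + h ^+ 2 * mixed_moment 0 2 j)).
Proof.
rewrite mixed_momentS !big_ord_recl !big_ord0 /= /bump /=.
rewrite !(addSn, add0n, addn0, subSS, subn0, subnn, bin0, bin1, binn, bin42, bin43, bin32).
rewrite !(step_moment0, step_moment2, @step_moment_odd 1 j isT, @step_moment_odd 3 j isT); ring.
Qed.

Lemma mixed_moment_rec13 j : mixed_moment 1 3 j.+1 =
  q * (mixed_moment 1 3 j + h * mixed_moment 0 4 j +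
  3 * h * (mixed_moment 1 1 j + h * mixed_moment 0 2 j)).
Proof.
rewrite mixed_momentS !big_ord_recl !big_ord0 /= /bump /=.
rewrite !(addSn, add0n, addn0, subSS, subn0, subnn, bin0, bin1, binn, bin42, bin43, bin32).
rewrite !(step_moment0, step_moment2, @step_moment_odd 1 j isT, @step_moment_odd 3 j isT); ring.
Qed.

(** The fourth moment of the step is left symbolic: [step_moment_even_le] bounds it by a multiple of
    [h ^+ 2], the order of the remainder. *)
Lemma mixed_moment_rec04 j : mixed_moment 0 4 j.+1 =
  q * (mixed_moment 0 4 j + 6 * h * mixed_moment 0 2 j + step_moment 4 j * mixed_moment 0 0 j).
Proof.
rewrite mixed_momentS !big_ord_recl !big_ord0 /= /bump /=.
rewrite !(addSn, add0n, addn0, subSS, subn0, subnn, bin0, bin1, binn, bin42, bin43, bin32).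
rewrite !(step_moment0, step_moment2, @step_moment_odd 1 j isT, @step_moment_odd 3 j isT); ring.
Qed.

(** One scalar that dominates all mixed moments of degree at most [2 * k], so that the whole
    recursion reduces to a Gronwall inequality for it alone. *)
Definition moment_sum (k j : nat) : R :=
  1 + mixed_moment (2 * k) 0 j + mixed_moment 0 (2 * k) j.

(** The monomial is at most [z ^+ (2 * n)] with [z] the maximum of 1, [|x|] and [|y|], and this
    power is one of the three terms. The zero exponents match the shape of [mixed_moment]. *)
Lemma monomial_le (x y : R) a b n : (a + b <= 2 * n)%N ->
  `|x ^+ a * y ^+ b| <= 1 + x ^+ (2 * n) * y ^+ 0 + x ^+ 0 * y ^+ (2 * n).
Proof.
move=> abn; pose z := Num.max 1 (Num.max `|x| `|y|).
have z1 : 1 <= z by rewrite le_max lexx.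
have z0 : 0 <= z by exact: le_trans z1.
have zx : `|x| <= z by rewrite !le_max lexx orbT.
have zy : `|y| <= z by rewrite !le_max lexx !orbT.
have e (t : R) : `|t| ^+ (2 * n) = t ^+ (2 * n) by rewrite !exprM real_normK// num_real.
have p (t : R) : 0 <= t ^+ (2 * n) by rewrite -e exprn_ge0.
apply: (@le_trans _ _ (z ^+ (2 * n))).
  apply: (@le_trans _ _ (z ^+ (a + b))); last by rewrite ler_weXn2l.
  rewrite exprD normrM !normrX; apply: ler_pM; rewrite ?exprn_ge0//;
    by apply: lerXn2r; rewrite ?nnegrE.
rewrite !expr0 mulr1 mul1r.
have := p x; have := p y; rewrite /z.
case: (leP 1 (Num.max `|x| `|y|)) => _; last by rewrite expr1n; lra.
by case: (leP `|x| `|y|) => _; rewrite e; lra.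
Qed.

Lemma mixed_moment_le a b k j : (a + b <= 2 * k)%N ->
  `|mixed_moment a b j| <= moment_sum k j.
Proof.
move=> abk; have aab := all_moments_mixed a b j.
apply: le_trans (norm_mean_le aab) _.
have aE : all_moments P (fun w => 1 + riemann_sum j w ^+ (2 * k) * position j w ^+ 0).
  by apply: all_momentsD; [exact: all_moments_cst|exact: all_moments_mixed].
rewrite /moment_sum -{1}(mean_cst P 1) /mixed_moment -!meanD//;
  try exact: all_moments_mixed; try exact: all_moments_cst.
apply: mean_le.
- split; first by apply: measurableT_comp => //; exact: all_moments_measurable aab.
  by move=> n; case: aab => _ /(_ n); apply: eq_integrable => // w _; rewrite /= normr_id.
- by apply: all_momentsD => //; exact: all_moments_mixed.
- by move=> w; exact: monomial_le.
Qed.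

Lemma moment_sum_ge0 k j : 0 <= moment_sum k j.
Proof. by apply: le_trans (@mixed_moment_le 0 0 k j _). Qed.

Definition step_const (l : nat) : R := (l./2)`!%:R * 4 ^+ l./2 * Num.sqrt 2.

Lemma step_const_ge0 l : 0 <= step_const l.
Proof. by rewrite !mulr_ge0 ?exprn_ge0. Qed.

(* The rate in the discrete Gronwall bound [moment_sum_le]. *)
Definition growth (k : nat) : R :=
  \sum_(l < 2 * k) 'C(2 * k, l.+1)%:R +
  \sum_(l < 2 * k) 'C(2 * k, l.+1)%:R * step_const l.+1.

Lemma growth_ge0 k : 0 <= growth k.
Proof.
by rewrite addr_ge0// sumr_ge0// => l _; rewrite mulr_ge0// step_const_ge0.
Qed.

Hypothesis h1 : h <= 1.

(** Odd moments vanish; an even one has order [h ^+ l./2] with [l./2] positive, hence at most order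
    [h] since [h <= 1]. *)
Lemma step_moment_le l j : (0 < l)%N -> `|step_moment l j| <= step_const l * h.
Proof.
move=> l0; have [ol|el] := boolP (odd l).
  by rewrite step_moment_odd// normr0 mulr_ge0 ?step_const_ge0// ltW.
have := odd_double_half l; rewrite (negbTE el) add0n -mul2n => lE.
have l2 : (0 < l./2)%N by rewrite half_gt0; case: l el l0 lE => [|[|]].
rewrite -{1}lE ger0_norm ?step_moment_even_ge0//.
apply: le_trans (step_moment_even_le _ _) _.
rewrite ler_wpM2l// ?step_const_ge0//.
by rewrite -[leRHS]expr1 ler_wiXn2l// ltW.
Qed.

Lemma mixed_moment0S_le k j : mixed_moment (2 * k) 0 j.+1 <=
  mixed_moment (2 * k) 0 j +
  h * (\sum_(l < 2 * k) 'C(2 * k, l.+1)%:R) * moment_sum k j.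
Proof.
rewrite mixed_moment0S big_ord_recl /= bin0 expr0 !mul1r subn0 lerD2l.
rewrite mulr_sumr mulr_suml; apply: ler_sum => l _; rewrite /bump /= add1n.
apply: (@le_trans _ _ ('C(2 * k, l.+1)%:R * h ^+ l.+1 * moment_sum k j)).
  rewrite ler_wpM2l//; first by rewrite mulr_ge0// exprn_ge0// ltW.
  by apply: le_trans (ler_norm _) (mixed_moment_le _ _); have := ltn_ord l; lia.
rewrite ler_wpM2r ?moment_sum_ge0// [leRHS]mulrC ler_wpM2l//.
by rewrite -[leRHS]expr1 ler_wiXn2l// ltW.
Qed.

Lemma mixed_momentS_le k j : (0 < k)%N -> mixed_moment 0 (2 * k) j.+1 <=
  mixed_moment 0 (2 * k) j +
  h * (\sum_(l < 2 * k) 'C(2 * k, l.+1)%:R * step_const l.+1) * moment_sum k j.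
Proof.
move=> k0; have -> : (2 * k = (2 * k).-1.+1)%N by lia.
set b := (2 * k).-1; rewrite mixed_momentS big_ord1.
set s := \sum_(_ < _) _; set t := (X in _ <= X).
have t0 : 0 <= t.
  rewrite addr_ge0//.
    rewrite /mixed_moment; apply: mean_ge0 => w; rewrite expr0 mul1r.
    have -> : b.+1 = (2 * k)%N by rewrite /b; lia.
    by rewrite exprM exprn_ge0// sqr_ge0.
  rewrite mulr_ge0 ?moment_sum_ge0// mulr_ge0 ?(ltW h0)// sumr_ge0// => l _.
  by rewrite mulr_ge0// step_const_ge0.
suff st : s <= t.
  apply: (@le_trans _ _ (q * t)); first by rewrite ler_wpM2l ?expR_ge0.
  by rewrite ler_piMl// -expR0 ler_expR oppr_le0 mulr_ge0 ?ltW.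
rewrite /s /t big_ord_recl /= !bin0 step_moment0 expr0 !mul1r !subn0 lerD2l.
rewrite mulr_sumr mulr_suml; apply: ler_sum => l _; rewrite /bump /= add1n.
rewrite ?(mul1r, mulr1) add0n.
apply: le_trans (ler_norm _) _; rewrite !normrM.
rewrite (ger0_norm (ler0n _ _)) -mulrA.
rewrite [leRHS](_ : _ = 'C(b.+1, l.+1)%:R * (step_const l.+1 * h * moment_sum k j)); last by ring.
rewrite ler_wpM2l//; apply: ler_pM => //; first exact: step_moment_le.
by apply: mixed_moment_le; rewrite /b; lia.
Qed.

(** A step multiplies the sum by at most [1 + growth k * h], which is below [expR (growth k * h)];
    the initial value is 1 because [k] is positive. *)
Lemma moment_sum_le k j : (0 < k)%N ->
  moment_sum k j <= expR (growth k * (j%:R * h)).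
Proof.
move=> k0; elim: j => [|j ih].
  rewrite /moment_sum !mixed_moment_init !expr0 mul0r mulr0 expR0.
  by rewrite expr0n muln_eq0 /= gtn_eqF// mul0r mulr0 !addr0.
apply: (@le_trans _ _ ((1 + growth k * h) * moment_sum k j)).
  have := mixed_moment0S_le k j; have := mixed_momentS_le j k0.
  set M := moment_sum k j; rewrite /growth; set s1 := \sum_(l < _) _; set s2 := \sum_(l < _) _ * _.
  have ME : M = 1 + mixed_moment (2 * k) 0 j + mixed_moment 0 (2 * k) j by [].
  rewrite /moment_sum (_ : (1 + (s1 + s2) * h) * M = M + h * s1 * M + h * s2 * M); last by ring.
  clearbody M s1 s2 => e1 e2; set x := h * s1 * M in e2 *; set y := h * s2 * M in e1 *.
  by rewrite ME; lra.
have -> : growth k * (j.+1%:R * h) = growth k * h + growth k * (j%:R * h).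
  by rewrite -natr1; ring.
rewrite expRD; apply: ler_pM => //; last exact: expR_ge1Dx.
  by rewrite addr_ge0// mulr_ge0 ?growth_ge0// ltW.
exact: moment_sum_ge0.
Qed.

End grid_moments.

(** * Convergence of Euler schemes *)

Section lipschitz_on.
Context (R : realType) (L : R).
Hypothesis L0 : 0 <= L.
Implicit Types f g : R -> R.

Definition lipschitz_on (f : R -> R) : Prop := exists2 K : R, 0 <= K &
  forall s t, 0 <= s <= L -> 0 <= t <= L -> `|f s - f t| <= K * `|s - t|.

Lemma lipschitz_on_bounded f : lipschitz_on f ->
  exists2 C : R, 0 <= C & forall t, 0 <= t <= L -> `|f t| <= C.
Proof.
move=> [K K0 Kf]; exists (K * L + `|f 0|); first by rewrite addr_ge0// mulr_ge0.
move=> t tL; rewrite -[X in `|X|](subrK (f 0)) (le_trans (ler_normD _ _))// lerD2r.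
rewrite (le_trans (Kf _ _ tL _)) ?lexx// ler_wpM2l// subr0.
by case/andP: tL => t0 tL; rewrite ger0_norm.
Qed.

Lemma lipschitz_on_cst c : lipschitz_on (fun=> c).
Proof. by exists 0 => // s t _ _; rewrite subrr normr0 mul0r. Qed.

Lemma lipschitz_on_id : lipschitz_on id.
Proof. by exists 1 => // s t _ _; rewrite mul1r. Qed.

Lemma lipschitz_onD f g : lipschitz_on f -> lipschitz_on g ->
  lipschitz_on (fun t => f t + g t).
Proof.
move=> [K K0 Kf] [M M0 Mg]; exists (K + M); first exact: addr_ge0.
move=> s t sL tL; rewrite opprD addrACA mulrDl (le_trans (ler_normD _ _))//.
by rewrite lerD ?Kf ?Mg.
Qed.

Lemma lipschitz_onM f g : lipschitz_on f -> lipschitz_on g ->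
  lipschitz_on (fun t => f t * g t).
Proof.
move=> lf lg; have [Cf Cf0 bf] := lipschitz_on_bounded lf.
have [Cg Cg0 bg] := lipschitz_on_bounded lg.
case: lf lg => [K K0 Kf] [M M0 Mg]; exists (K * Cg + Cf * M).
  by rewrite addr_ge0// mulr_ge0.
move=> s t sL tL.
have -> : f s * g s - f t * g t = (f s - f t) * g s + f t * (g s - g t) by ring.
rewrite (le_trans (ler_normD _ _))// !normrM mulrDl; apply: lerD.
  by rewrite mulrAC; apply: ler_pM => //; [exact: Kf|exact: bg].
by rewrite -mulrA; apply: ler_pM => //; [exact: bf|exact: Mg].
Qed.

Lemma lipschitz_onN f : lipschitz_on f -> lipschitz_on (fun t => - f t).
Proof.
by move=> [K K0 Kf]; exists K => // s t sL tL; rewrite -opprD normrN Kf.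
Qed.

Lemma lipschitz_onX f n : lipschitz_on f -> lipschitz_on (fun t => f t ^+ n).
Proof.
move=> lf; elim: n => [|n ih]; first exact: lipschitz_on_cst.
by under eq_fun do rewrite exprS; exact: lipschitz_onM.
Qed.

Lemma lipschitz_on_expR c : lipschitz_on (fun t => expR (c * t)).
Proof.
pose K := `|c| * expR (`|c| * L); exists K; first by rewrite mulr_ge0 ?expR_ge0.
have key s t : 0 <= s <= L -> 0 <= t <= L -> expR (c * s) - expR (c * t) <= K * `|s - t|.
  move=> /andP[s0 sL] /andP[t0 tL].
  (* By convexity, the tangent at [c * s] lies below the exponential at [c * t]. *)
  have h : expR (c * s) - expR (c * t) <= expR (c * s) * (c * (s - t)).
    have := expR_ge1Dx (c * (t - s)).
    rewrite -(ler_pM2l (expR_gt0 (c * s))) -expRD.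
    have -> : c * s + c * (t - s) = c * t by ring.
    lra.
  apply: (le_trans h); rewrite mulrA [X in X <= _]mulrC.
  rewrite (le_trans (ler_norm _))// !normrM (ger0_norm (expR_ge0 _)) /K.
  rewrite mulrC ler_wpM2r// [leRHS]mulrC ler_wpM2r// ler_expR.
  by rewrite (le_trans (ler_norm _))// normrM ler_wpM2l// ger0_norm.
move=> s t sL tL; rewrite ler_norml key// andbT lerNl opprB distrC.
exact: key.
Qed.

End lipschitz_on.

Section scheme.
Context (R : realType) (L : R).
Hypothesis L0 : 0 <= L.
Implicit Types (u v : R -> nat -> R) (f g : R -> R).

Definition bounded_family (u : R -> nat -> R) : Prop := exists2 C : R, 0 <= C &
  forall (h : R) (j : nat), 0 < h -> h <= 1 -> j%:R * h <= L -> `|u h j| <= C.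

Definition close_family (u : R -> nat -> R) (f : R -> R) : Prop := exists2 C : R, 0 <= C &
  forall (h : R) (j : nat), 0 < h -> h <= 1 -> j%:R * h <= L -> `|u h j - f (j%:R * h)| <= C * h.

Lemma bounded_familyD u v : bounded_family u -> bounded_family v ->
  bounded_family (fun h j => u h j + v h j).
Proof.
move=> [C C0 Cu] [D D0 Dv]; exists (C + D); first exact: addr_ge0.
by move=> h j h0 h1 jL; rewrite (le_trans (ler_normD _ _))// lerD ?Cu ?Dv.
Qed.

Lemma bounded_familyM u v : bounded_family u -> bounded_family v ->
  bounded_family (fun h j => u h j * v h j).
Proof.
move=> [C C0 Cu] [D D0 Dv]; exists (C * D); first exact: mulr_ge0.
by move=> h j h0 h1 jL; rewrite normrM; apply: ler_pM; rewrite ?Cu ?Dv.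
Qed.

Lemma bounded_family_cst c : bounded_family (fun _ _ => c).
Proof. by exists `|c|. Qed.

Lemma bounded_family_step : bounded_family (fun h _ => h).
Proof. by exists 1 => // h j h0 h1 _; rewrite gtr0_norm. Qed.

Lemma bounded_familyX u n : bounded_family u ->
  bounded_family (fun h j => u h j ^+ n).
Proof.
move=> bu; elim: n => [|n ih]; first exact: bounded_family_cst.
have [C C0 H] := bounded_familyM bu ih; exists C => // h j h0 h1 jL.
by rewrite exprS; exact: H.
Qed.

Lemma close_family_bounded u f : lipschitz_on L f -> close_family u f ->
  bounded_family u.
Proof.
move=> /lipschitz_on_bounded -/(_ L0)[D D0 Df] [C C0 Cu]; exists (C + D); first exact: addr_ge0.
move=> h j h0 h1 jL; rewrite -[X in `|X|](subrK (f (j%:R * h))).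
rewrite (le_trans (ler_normD _ _))// lerD//.
  by apply: (le_trans (Cu _ _ h0 h1 jL)); rewrite ler_piMr.
by apply: Df; rewrite jL mulr_ge0// ltW.
Qed.

Lemma close_familyD u v f g : close_family u f -> close_family v g ->
  close_family (fun h j => u h j + v h j) (fun t => f t + g t).
Proof.
move=> [C C0 Cu] [D D0 Dv]; exists (C + D); first exact: addr_ge0.
move=> h j h0 h1 jL; rewrite opprD addrACA mulrDl (le_trans (ler_normD _ _))//.
by rewrite lerD ?Cu ?Dv.
Qed.

Lemma close_familyZ c u f : close_family u f ->
  close_family (fun h j => c * u h j) (fun t => c * f t).
Proof.
move=> [C C0 Cu]; exists (`|c| * C); first exact: mulr_ge0.
by move=> h j h0 h1 jL; rewrite -mulrBr normrM -mulrA ler_wpM2l// Cu.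
Qed.

Lemma close_family_cst c : close_family (fun _ _ => c) (fun=> c).
Proof. by exists 0 => // h j _ _ _; rewrite subrr normr0 mul0r. Qed.

(* Multiplying by the integrating factor [expR (rho * t)] turns the ODE
   [g' = F - rho * g] into [G' = Phi]. *)
Lemma close_family_scheme (rho : R) u v (rest : R -> nat -> R) (G Phi : R -> R) :
  0 <= rho -> G 0 = 0 ->
  (forall t : R, is_derive t (1 : R) G (Phi t)) -> lipschitz_on L Phi ->
  (forall h, 0 < h -> u h 0%N = 0) ->
  (forall h j, 0 < h -> h <= 1 -> u h j.+1 =
     expR (- (rho * h)) * (u h j + h * v h j + h ^+ 2 * rest h j)) ->
  bounded_family rest ->
  close_family v (fun t => expR (- (rho * t)) * Phi t) ->
  close_family u (fun t => expR (- (rho * t)) * G t).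
Proof.
move=> rho0 G0 dG [K K0 KPhi] u0 uS [D D0 Dr] [C C0 Cv].
exists ((K + C + D) * L); first by rewrite mulr_ge0// !addr_ge0.
move=> h j h0 h1 jL.
(* The inductive bound is proportional to elapsed time. One step adds [h ^+ 2] times [K] (variation
   of [Phi] over the step), [C] (error of [v]) and [D] (remainder), while the factor
   [expR (- (rho * h))] does not amplify earlier errors. *)
suff H : `|u h j - expR (- (rho * (j%:R * h))) * G (j%:R * h)| <=
    (K + C + D) * (j%:R * h) * h.
  by apply: (le_trans H); rewrite ler_wpM2r ?(ltW h0)// ler_wpM2l// !addr_ge0.
elim: j jL => [|j ih] jL.
  by rewrite u0// !mul0r G0 !mulr0 subrr normr0 mul0r.
have jSE : j.+1%:R * h = j%:R * h + h by rewrite -natr1; ring.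
have jL' : j%:R * h <= L by rewrite (le_trans _ jL)// jSE lerDl ltW.
have {}ih := ih jL'; rewrite uS// jSE.
set t := j%:R * h in ih jL' jSE *.
have t0 : 0 <= t by rewrite mulr_ge0// ltW.
have t1L : t + h <= L by rewrite -jSE.
have tth : t < t + h by rewrite ltrDl.
have [c ctth Gc] : exists2 c, c \in `]t, t + h[ & G (t + h) - G t = Phi c * (t + h - t).
  have cG : {within `[t, t + h], continuous G}.
    by apply: derivable_within_continuous => x _; case: (dG x).
  exact: (MVT tth (fun x _ => dG x) cG).
have {Gc} Gc : G (t + h) = G t + Phi c * h by rewrite -[LHS](subrK (G t)) Gc; ring.
have Kc : `|Phi t - Phi c| <= K * h.
  move: ctth; rewrite in_itv/= => /andP[tc cth].
  apply: (@le_trans _ _ (K * `|t - c|)).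
    by apply: KPhi; rewrite ?t0 ?jL'// (le_trans t0) ?(ltW tc)//= (le_trans (ltW cth)).
  rewrite ler_wpM2l// ler0_norm ?subr_le0 ?(ltW tc)//; lra.
have e1 : expR (- (rho * (t + h))) = expR (- (rho * h)) * expR (- (rho * t)).
  by rewrite -expRD; congr expR; ring.
have le1 s : 0 <= s -> expR (- (rho * s)) <= 1.
  by move=> s0; rewrite -expR0 ler_expR oppr_le0 mulr_ge0.
rewrite e1 Gc -mulrA -mulrBr normrM (ger0_norm (expR_ge0 _)).
apply: (@le_trans _ _ (1 * ((K + C + D) * t * h + (K + C + D) * h ^+ 2))); last first.
  by rewrite mul1r; lra.
apply: ler_pM; rewrite ?expR_ge0 ?le1 ?(ltW h0)//.
set e := expR (- (rho * t)); have e0 : 0 <= e by exact: expR_ge0.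
have -> : u h j + h * v h j + h ^+ 2 * rest h j - e * (G t + Phi c * h) =
   (u h j - e * G t) + h * (v h j - e * Phi t) + h ^+ 2 * rest h j
    + h * (e * (Phi t - Phi c)) by ring.
apply: le_trans (ler_normD _ _) _.
have hn : `|h| = h by rewrite gtr0_norm.
have b1 : `|h * (v h j - e * Phi t)| <= C * h ^+ 2.
  rewrite normrM hn expr2 mulrA mulrC ler_wpM2r ?(ltW h0)//; exact: Cv.
have b2 : `|h ^+ 2 * rest h j| <= D * h ^+ 2.
  by rewrite normrM normrX hn mulrC ler_wpM2r ?sqr_ge0// Dr.
have b3 : `|h * (e * (Phi t - Phi c))| <= K * h ^+ 2.
  rewrite normrM hn expr2 mulrA mulrC ler_wpM2r ?(ltW h0)// normrM ger0_norm//.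
  by rewrite -[leRHS]mul1r; apply: ler_pM => //; exact: le1.
have := ler_normD (u h j - e * G t + h * (v h j - e * Phi t)) (h ^+ 2 * rest h j).
have := ler_normD (u h j - e * G t) (h * (v h j - e * Phi t)).
lra.
Qed.

End scheme.

(** * The limiting differential equations and their explicit solution *)

Section ode.
Context (R : realType) (r : R).
Hypothesis r0 : 0 < r.

Let rN0 : r != 0. Proof. by rewrite gt_eqF. Qed.
Let expN0 (t : R) : expR (r * t) != 0. Proof. by rewrite gt_eqF// expR_gt0. Qed.

Definition second_moment (t : R) : R :=
  2 / r ^+ 3 * (r * t - 2 + expR (- (r * t)) * (2 + r * t)).

Definition fourth_moment (t : R) : R :=
  1 / r ^+ 6 * (12 * (r * t) ^+ 2 + 120 * (r * t) - 840
     + expR (- (r * t)) *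
       (9 * (r * t) ^+ 4 + 68 * (r * t) ^+ 3 + 288 * (r * t) ^+ 2
        + 720 * (r * t) + 840)).

(* [Gab] is [exp(r t)] times the limit of the mixed moment [E(A_t^a W_t^b)]. *)
Definition G02 (t : R) : R := (expR (r * t) - 1) / r.
Definition G11 (t : R) : R := (expR (r * t) - 1 - r * t) / r ^+ 2.
Definition G13 (t : R) : R :=
  9 * (expR (r * t) - 1 - r * t - (r * t) ^+ 2 / 2) / r ^+ 3.
Definition G22 (t : R) : R := ((12 + 2 * (r * t)) * expR (r * t) -
  (12 + 14 * (r * t) + 8 * (r * t) ^+ 2 + 3 * (r * t) ^+ 3)) / r ^+ 4.
Definition G31 (t : R) : R := ((30 + 6 * (r * t)) * expR (r * t) -
  (30 + 36 * (r * t) + 21 * (r * t) ^+ 2 + 8 * (r * t) ^+ 3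
   + 9 / 4 * (r * t) ^+ 4)) / r ^+ 5.

Ltac derive_explicit :=
  apply: is_derive_eq; rewrite /GRing.scale /=.

Lemma is_derive_G02 (t : R) : is_derive t (1 : R) G02 (expR (r * t)).
Proof. by derive_explicit; field. Qed.

Lemma is_derive_G11 (t : R) : is_derive t (1 : R) G11 (G02 t).
Proof. by derive_explicit; rewrite /G02; field. Qed.

Lemma is_derive_G13 (t : R) : is_derive t (1 : R) G13 (9 * G11 t).
Proof. by derive_explicit; rewrite /G11; field. Qed.

(** [second_moment] is the limit for [b = 0] and carries no integrating factor, so [expR (r * t)]
    has to be supplied when it enters a damped equation. *)
Lemma is_derive_G22 (t : R) : is_derive t (1 : R) G22
  (2 * G13 t + expR (r * t) * second_moment t).
Proof.
derive_explicit; rewrite /G13 /second_moment expRN.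
by field; rewrite rN0 expN0.
Qed.

Lemma is_derive_G31 (t : R) : is_derive t (1 : R) G31 (3 * G22 t).
Proof. by derive_explicit; rewrite /G22; field. Qed.

Lemma is_derive_second_moment (t : R) :
  is_derive t (1 : R) second_moment (2 * (expR (- (r * t)) * G11 t)).
Proof.
derive_explicit; rewrite /G11 expRN.
by field; rewrite rN0 expN0.
Qed.

Lemma is_derive_fourth_moment (t : R) :
  is_derive t (1 : R) fourth_moment (4 * (expR (- (r * t)) * G31 t)).
Proof.
derive_explicit; rewrite /G31 expRN.
by field; rewrite rN0 expN0.
Qed.

Context (L : R).
Hypothesis L0 : 0 <= L.

Ltac lipschitz_explicit := repeat first
  [ exact: lipschitz_on_cst | exact: lipschitz_on_id | exact: lipschitz_on_expR
  | apply: lipschitz_onD | apply: lipschitz_onN | apply: lipschitz_onM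
  | apply: lipschitz_onX ].

Let close_ext (u : R -> nat -> R) f g : f =1 g ->
  close_family L u f -> close_family L u g.
Proof. by move=> /funext ->. Qed.

Context (u : nat -> nat -> R -> nat -> R) (m4 : R -> nat -> R).
Let q h := expR (- (r * h)).
Hypothesis u_init : forall a b h, 0 < h -> (0 < a + b)%N -> u a b h 0%N = 0.
Hypothesis m4_le : bounded_family L (fun h j => m4 h j / h ^+ 2).
Hypothesis rec02 : forall h j, 0 < h -> h <= 1 ->
  u 0 2 h j.+1 = q h * (u 0 2 h j + h).
Hypothesis rec11 : forall h j, 0 < h -> h <= 1 ->
  u 1 1 h j.+1 = q h * (u 1 1 h j + h * u 0 2 h j).
Hypothesis rec20 : forall h j, 0 < h -> h <= 1 -> u 2 0 h j.+1 =
  u 2 0 h j + 2 * h * u 1 1 h j + h ^+ 2 * u 0 2 h j.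
Hypothesis rec04 : forall h j, 0 < h -> h <= 1 -> u 0 4 h j.+1 =
  q h * (u 0 4 h j + 6 * h * u 0 2 h j + m4 h j).
Hypothesis rec13 : forall h j, 0 < h -> h <= 1 -> u 1 3 h j.+1 =
  q h * (u 1 3 h j + h * u 0 4 h j + 3 * h * (u 1 1 h j + h * u 0 2 h j)).
Hypothesis rec22 : forall h j, 0 < h -> h <= 1 -> u 2 2 h j.+1 =
  q h * (u 2 2 h j + 2 * h * u 1 3 h j + h ^+ 2 * u 0 4 h j +
    h * (u 2 0 h j + 2 * h * u 1 1 h j + h ^+ 2 * u 0 2 h j)).
Hypothesis rec31 : forall h j, 0 < h -> h <= 1 -> u 3 1 h j.+1 =
  q h * (u 3 1 h j + 3 * h * u 2 2 h j + 3 * h ^+ 2 * u 1 3 h j +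
    h ^+ 3 * u 0 4 h j).
Hypothesis rec40 : forall h j, 0 < h -> h <= 1 -> u 4 0 h j.+1 =
  u 4 0 h j + 4 * h * u 3 1 h j + 6 * h ^+ 2 * u 2 2 h j +
  4 * h ^+ 3 * u 1 3 h j + h ^+ 4 * u 0 4 h j.

Let decay (G : R -> R) (t : R) : R := expR (- (r * t)) * G t.

Let lipschitz_decay G : lipschitz_on L G -> lipschitz_on L (decay G).
Proof.
move=> lG; apply: lipschitz_onM => //.
under eq_fun do rewrite -mulNr.
exact: lipschitz_on_expR.
Qed.

Let lip02 : lipschitz_on L G02. Proof. by rewrite /G02; lipschitz_explicit. Qed.
Let lip11 : lipschitz_on L G11. Proof. by rewrite /G11; lipschitz_explicit. Qed.
Let lip13 : lipschitz_on L G13. Proof. by rewrite /G13; lipschitz_explicit. Qed.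
Let lip22 : lipschitz_on L G22. Proof. by rewrite /G22; lipschitz_explicit. Qed.
Let lip31 : lipschitz_on L G31. Proof. by rewrite /G31; lipschitz_explicit. Qed.

Lemma lipschitz_on_second_moment : lipschitz_on L second_moment.
Proof.
rewrite /second_moment; under eq_fun do rewrite -mulNr.
by lipschitz_explicit.
Qed.

Lemma lipschitz_on_fourth_moment : lipschitz_on L fourth_moment.
Proof.
rewrite /fourth_moment; under eq_fun do rewrite -mulNr.
by lipschitz_explicit.
Qed.

Let step_decay (a b : nat) (v rest : R -> nat -> R) (G Phi : R -> R) :
  (0 < a + b)%N -> G 0 = 0 ->
  (forall t : R, is_derive t (1 : R) G (Phi t)) -> lipschitz_on L Phi ->
  (forall h j, 0 < h -> h <= 1 -> u a b h j.+1 =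
     q h * (u a b h j + h * v h j + h ^+ 2 * rest h j)) ->
  bounded_family L rest -> close_family L v (decay Phi) ->
  close_family L (u a b) (decay G).
Proof.
move=> ab G0 dG lPhi uS br cv.
apply: (close_family_scheme L0 (ltW r0) G0 dG lPhi _ uS br cv).
by move=> h h0; exact: u_init.
Qed.

(** For the undamped moments, those with [b = 0]: the general scheme at rate 0, where the
    integrating factor is 1. *)
Let step_free (a b : nat) (v rest : R -> nat -> R) (G Phi : R -> R) :
  (0 < a + b)%N -> G 0 = 0 ->
  (forall t : R, is_derive t (1 : R) G (Phi t)) -> lipschitz_on L Phi ->
  (forall h j, 0 < h -> h <= 1 -> u a b h j.+1 =
     u a b h j + h * v h j + h ^+ 2 * rest h j) ->
  bounded_family L rest -> close_family L v Phi ->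
  close_family L (u a b) G.
Proof.
move=> ab G0 dG lPhi uS br cv.
have e (f : R -> R) : (fun t => expR (- (0 * t)) * f t) =1 f.
  by move=> t; rewrite mul0r oppr0 expR0 mul1r.
apply: (close_ext (e G)).
apply: (close_family_scheme L0 (lexx 0) G0 dG lPhi _ _ br).
- by move=> h h0; exact: u_init.
- by move=> h j h0 h1; rewrite mul0r oppr0 expR0 mul1r; exact: uS.
- by apply: close_ext cv => t; rewrite e.
Qed.

Ltac bounded_explicit := repeat first
  [ exact: bounded_family_cst | exact: bounded_family_step | assumption
  | apply: bounded_familyD | apply: bounded_familyM | apply: bounded_familyX ].

Lemma close_02 : close_family L (u 0 2) (decay G02).
Proof.
apply: (@step_decay 0 2 (fun _ _ => 1) (fun _ _ => 0) _ _ isT _ is_derive_G02).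
- by rewrite /G02 mulr0 expR0 subrr mul0r.
- exact: lipschitz_on_expR.
- by move=> h j h0 h1; rewrite rec02// mulr1 mulr0 addr0.
- exact: bounded_family_cst.
- apply: (@close_ext _ (fun=> 1)); last exact: close_family_cst.
  by move=> t; rewrite /decay -expRD addNr expR0.
Qed.

Let bounded_02 : bounded_family L (u 0 2).
Proof. exact: (close_family_bounded L0 (lipschitz_decay lip02) close_02). Qed.

Lemma close_11 : close_family L (u 1 1) (decay G11).
Proof.
apply: (@step_decay 1 1 (u 0 2) (fun _ _ => 0) _ _ isT _ is_derive_G11 lip02).
- by rewrite /G11 !mulr0 expR0 !subrr mul0r.
- by move=> h j h0 h1; rewrite rec11// mulr0 addr0.
- exact: bounded_family_cst.
- exact: close_02.
Qed.

Let bounded_11 : bounded_family L (u 1 1).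
Proof. exact: (close_family_bounded L0 (lipschitz_decay lip11) close_11). Qed.

Lemma close_20 : close_family L (u 2 0) second_moment.
Proof.
apply: (@step_free 2 0 (fun h j => 2 * u 1 1 h j) (u 0 2) _ _ isT _ is_derive_second_moment).
- by rewrite /second_moment !mulr0 oppr0 expR0; ring.
- by apply: lipschitz_onM => //; [exact: lipschitz_on_cst|exact: lipschitz_decay].
- by move=> h j h0 h1; rewrite rec20//; ring.
- exact: bounded_02.
- exact: (close_familyZ 2 close_11).
Qed.

Let bounded_20 : bounded_family L (u 2 0).
Proof. exact: (close_family_bounded L0 lipschitz_on_second_moment close_20). Qed.

(** In the limit the moment (0,4) solves the equation of the moment (1,1) with source multiplied by
    6, so it is 6 times that solution. *)
Lemma close_04 : close_family L (u 0 4) (decay (fun t => 6 * G11 t)).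
Proof.
apply: (@step_decay 0 4 (fun h j => 6 * u 0 2 h j) (fun h j => m4 h j / h ^+ 2)
  _ (fun t => 6 * G02 t) isT).
- by rewrite /G11 !mulr0 expR0 !subrr mul0r mulr0.
- by move=> t; rewrite /G11; derive_explicit; rewrite /G02; field.
- by apply: lipschitz_onM => //; exact: lipschitz_on_cst.
- move=> h j h0 h1; rewrite rec04// [h ^+ 2 * _]mulrC divfK ?expf_neq0 ?gt_eqF//.
  by rewrite mulrCA mulrA.
- exact: m4_le.
- by apply: close_ext (close_familyZ 6 close_02) => t; rewrite /decay mulrCA.
Qed.

Let bounded_04 : bounded_family L (u 0 4).
Proof.
apply: (close_family_bounded L0 _ close_04); apply: lipschitz_decay.
by apply: lipschitz_onM => //; exact: lipschitz_on_cst.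
Qed.

Lemma close_13 : close_family L (u 1 3) (decay G13).
Proof.
apply: (@step_decay 1 3 (fun h j => u 0 4 h j + 3 * u 1 1 h j)
  (fun h j => 3 * u 0 2 h j) _ _ isT _ is_derive_G13).
- by rewrite /G13 !mulr0 expR0; field.
- by apply: lipschitz_onM => //; exact: lipschitz_on_cst.
- by move=> h j h0 h1; rewrite rec13//; ring.
- by bounded_explicit.
- apply: close_ext (close_familyD close_04 (close_familyZ 3 close_11)) => t.
  by rewrite /decay; ring.
Qed.

Let bounded_13 : bounded_family L (u 1 3).
Proof. exact: (close_family_bounded L0 (lipschitz_decay lip13) close_13). Qed.

Lemma close_22 : close_family L (u 2 2) (decay G22).
Proof.
apply: (@step_decay 2 2 (fun h j => 2 * u 1 3 h j + u 2 0 h j)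
  (fun h j => u 0 4 h j + 2 * u 1 1 h j + h * u 0 2 h j) _ _ isT _ is_derive_G22).
- by rewrite /G22 !mulr0 expR0; field.
- apply: lipschitz_onD; apply: lipschitz_onM => //; first exact: lipschitz_on_cst.
    exact: lipschitz_on_expR.
  exact: lipschitz_on_second_moment.
- by move=> h j h0 h1; rewrite rec22//; ring.
- by bounded_explicit.
- apply: close_ext (close_familyD (close_familyZ 2 close_13) close_20) => t.
  by rewrite /decay expRN; field; exact: expN0.
Qed.

Let bounded_22 : bounded_family L (u 2 2).
Proof. exact: (close_family_bounded L0 (lipschitz_decay lip22) close_22). Qed.

Lemma close_31 : close_family L (u 3 1) (decay G31).
Proof.
apply: (@step_decay 3 1 (fun h j => 3 * u 2 2 h j)
  (fun h j => 3 * u 1 3 h j + h * u 0 4 h j) _ _ isT _ is_derive_G31).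
- by rewrite /G31 !mulr0 expR0; field.
- by apply: lipschitz_onM => //; exact: lipschitz_on_cst.
- by move=> h j h0 h1; rewrite rec31//; ring.
- by bounded_explicit.
- by apply: close_ext (close_familyZ 3 close_22) => t; rewrite /decay mulrCA.
Qed.

Lemma close_40 : close_family L (u 4 0) fourth_moment.
Proof.
apply: (@step_free 4 0 (fun h j => 4 * u 3 1 h j)
  (fun h j => 6 * u 2 2 h j + 4 * (h * u 1 3 h j) + h ^+ 2 * u 0 4 h j)
  _ _ isT _ is_derive_fourth_moment).
- by rewrite /fourth_moment !mulr0 oppr0 expR0; ring.
- by apply: lipschitz_onM => //; [exact: lipschitz_on_cst|exact: lipschitz_decay].
- by move=> h j h0 h1; rewrite rec40//; ring.
- by bounded_explicit.
- exact: (close_familyZ 4 close_31).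
Qed.

End ode.

(** * Riemann sums along a path *)

Section real_facts.
Context (R : realType).

Lemma within_continuous_dist (f : R -> R) (x e : R) :
  {within `[0, +oo[, continuous f} -> 0 <= x -> 0 < e ->
  exists2 delta : R, 0 < delta &
    forall s, 0 <= s -> `|s - x| < delta -> `|f s - f x| <= e.
Proof.
move=> /subspace_continuousP cf x0 e0.
have xA : (`[0, +oo[%classic : set R) x by rewrite /= in_itv/= x0.
have /cvgrPdist_le /(_ _ e0) := cf x xA.
move=> /nbhs_ballP[delta /= d0 h]; exists delta => // s s0 sd.
rewrite distrC; apply: h; last by rewrite /= in_itv/= s0.
by rewrite /ball /= distrC.
Qed.

Lemma within_continuous_bounded (f : R -> R) (T : R) :
  {within `[0, +oo[, continuous f} -> 0 <= T ->
  exists2 M : R, 0 <= M & forall s, 0 <= s <= T -> `|f s| <= M.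
Proof.
move=> cf T0.
have cf' : {within `[0, T], continuous f}.
  by apply: continuous_subspaceW cf => s /=; rewrite !in_itv/= => /andP[-> _].
have [c _ hc] := EVT_max T0 cf'; have [c' _ hc'] := EVT_min T0 cf'.
exists (`|f c| + `|f c'|); first exact: addr_ge0.
move=> s sT; have sT' : s \in `[0, T] by rewrite in_itv.
have := hc _ sT'; have := hc' _ sT'.
have := ler_norm (f c); have := ler_norm (- f c'); rewrite normrN.
have := normr_ge0 (f c); have := normr_ge0 (f c').
by rewrite ler_norml; lra.
Qed.

Lemma cvg_dist_le (u : nat -> R) (l : R) :
  (forall e, 0 < e -> exists m0, forall m, (m0 <= m)%N -> `|u m - l| <= e) ->
  u @ \oo --> l.
Proof.
move=> h; apply/cvgrPdist_le => e e0; have [m0 hm] := h _ e0.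
by exists m0 => // m /= mm; rewrite distrC; exact: hm.
Qed.

Definition mesh (T : R) (m : nat) : R := T / m.+1%:R.

Lemma mesh_gt0 T m : 0 < T -> 0 < mesh T m.
Proof. by move=> T0; rewrite divr_gt0. Qed.

Lemma mesh_lt T e : 0 < e -> exists m0, forall m, (m0 <= m)%N -> mesh T m < e.
Proof.
move=> e0; exists (Num.truncn (`|T| / e)).+1 => m mm.
rewrite ltr_pdivrMr// (le_lt_trans (ler_norm _))// mulrC -ltr_pdivrMr//.
apply: (@lt_trans _ _ (Num.truncn (`|T| / e)).+1%:R); last by rewrite ltr_nat.
by have /andP[] := truncn_itv (divr_ge0 (normr_ge0 T) (ltW e0)).
Qed.

End real_facts.

Section pathwise.
Context (d : measure_display) (Omega : measurableType d) (R : realType)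
  (P : probability Omega R) (r : R) (N : R -> {RV P >-> nat})
  (B : nat -> R -> {RV P >-> R}) (W : R -> Omega -> R).
Hypothesis ppN : poisson_process r N.
Hypothesis bmB : forall k, standard_brownian_motion (B k).
Hypothesis WE : forall t w, 0 <= t -> W t w = B (N t w) (t - last_reset N t w) w.
Context (w : Omega).

Let resets (t : R) := [set s : R | 0 <= s /\ N s w = N t w].

Let continuous_B k : {within `[0, +oo[, continuous (fun t => B k t w)}.
Proof. exact: (bm_continuous (bmB k)). Qed.

Let has_inf_resets t : 0 <= t -> has_inf (resets t).
Proof. by move=> t0; split; [exists t|exists 0 => s []]. Qed.

Lemma last_reset_le s t : 0 <= s -> N s w = N t w -> last_reset N t w <= s.
Proof. by move=> s0 e; apply: ge_inf => //; exists 0 => ? []. Qed.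

Lemma last_reset_ge0 t : 0 <= t -> 0 <= last_reset N t w.
Proof. by move=> t0; apply: lb_le_inf; [exists t|move=> s []]. Qed.

(** Otherwise some [u < s] would already have the count of [t], and monotonicity would force the
    same count at [s]. *)
Lemma le_last_reset s t : 0 <= s -> 0 <= t -> N s w <> N t w -> s <= t ->
  s <= last_reset N t w.
Proof.
move=> s0 t0 st le_st; rewrite leNgt; apply/negP => lt.
have e0 : 0 < s - last_reset N t w by rewrite subr_gt0.
have [u [u0 ut] us] := inf_adherent e0 (has_inf_resets t0).
have {}us : u < s by move: us; rewrite -/(last_reset N t w); lra.
apply: st; apply/eqP; rewrite eqn_leq (pp_nondecreasing ppN)//= -ut.
by apply: (pp_nondecreasing ppN) => //; exact: ltW.
Qed.

(** Rounding moves the current time and the start of the piece both forward, each by an amount in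
    [[0, h]]; the age changes by the difference of these amounts. *)
Lemma age_close h i t : 0 < h -> 0 <= t -> N (i%:R * h) w = N t w ->
  t < i%:R * h <= t + h ->
  `|age h (cnt N h w) i i - (t - last_reset N t w)| <= h.
Proof.
move=> h0 t0 it /andP[ti ith]; set n := cnt N h w; set i0 := first_index n i.
have i0i : (i0 <= i)%N by exact: first_index_le.
have ni : n i = N t w by exact: it.
have ni0 : n i0 = n i.
  have [lt|ge] := boolP (has (fun k => n k == n i) (iota 0 i)).
    have := nth_find 0%N lt; rewrite -/(first_index n i) -/i0 nth_iota ?add0n; first by move/eqP.
    by rewrite -[X in (_ < X)%N](size_iota 0) -has_find.
  by rewrite /i0 /first_index hasNfind// size_iota.
have L1 : last_reset N t w <= i0%:R * h.
  apply: last_reset_le; first by rewrite mulr_ge0// ltW.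
  by rewrite -ni -ni0.
have L2 : i0%:R * h <= last_reset N t w + h.
  case E : i0 => [|k]; first by rewrite mul0r addr_ge0 ?last_reset_ge0// ltW.
  have ki : (k < i)%N by rewrite -E in i0i *; rewrite (leq_trans _ i0i)// E.
  have nk : n k <> n i.
    move=> e; have /(_ k) := @before_find _ 0%N (fun k => n k == n i) (iota 0 i).
    rewrite -/(first_index n i) -/i0 E ltnSn => /(_ isT).
    by rewrite nth_iota// add0n e eqxx.
  (* A grid time after [t] but before [i%:R * h] would be squeezed between equal counts,
     contradicting [nk]. *)
  have ksmall : k%:R * h <= t.
    rewrite leNgt; apply/negP => tk; apply: nk; apply/eqP.
    rewrite eqn_leq (cnt_le ppN h0)//= ?(ltnW ki)// ni.
    by apply: (pp_nondecreasing ppN) => //; exact: ltW.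
  rewrite -natr1 mulrDl mul1r lerD2r; apply: le_last_reset => //.
    by rewrite mulr_ge0// ltW.
  by rewrite -ni.
rewrite /age -/i0 natrB// mulrBl ler_norml; lra.
Qed.

Context (T : R).
Hypothesis T0 : 0 < T.

Lemma pieces_bounded : exists2 M : R, 0 <= M & forall k s,
  (k <= N T w)%N -> 0 <= s <= T -> `|B k s w| <= M.
Proof.
have /choice[M MP] : forall k, exists M : R, 0 <= M /\
    forall s, 0 <= s <= T -> `|B k s w| <= M.
  by move=> k; have [M M0 HM] := within_continuous_bounded (@continuous_B k) (ltW T0); exists M.
exists (\sum_(k < (N T w).+1) M k); first by apply: sumr_ge0 => k _; case: (MP k).
move=> k s kN sT; apply: (@le_trans _ _ (M k)); first by case: (MP k) => _; apply.
rewrite (bigD1 (Ordinal (kN : (k < (N T w).+1)%N)))//= lerDl sumr_ge0// => i _.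
by case: (MP i).
Qed.

Lemma position_pieces m i : (i <= m.+1)%N ->
  let h := mesh T m in
  (cnt N h w i <= N T w)%N /\ 0 <= age h (cnt N h w) i i <= T.
Proof.
move=> im h; have h0 := mesh_gt0 m T0.
have iT : i%:R * h <= T.
  by rewrite /h /mesh mulrA ler_pdivrMr// mulrC ler_pM2l// ler_nat.
split.
  by apply: (pp_nondecreasing ppN) => //; rewrite mulr_ge0// ltW.
rewrite age_ge0//=; apply: le_trans iT; rewrite ler_wpM2r ?(ltW h0)// ler_nat.
exact: leq_subr.
Qed.

(* The position at the first grid time strictly after [t]: with this choice right
   continuity of the counting path is enough for convergence. *)
Definition staircase (m : nat) (t : R) : R :=
  position N B (mesh T m) (Num.truncn (t / mesh T m)).+1 w.

(** For small meshes the next grid time has the count of [t], so both sides follow the same piece,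
    at ages differing by at most the mesh. *)
Lemma staircase_cvg t : 0 <= t -> staircase ^~ t @ \oo --> W t w.
Proof.
move=> t0; apply: cvg_dist_le => e e0.
have /nbhs_ballP[d1 /= d10 rc] := pp_right_continuous ppN w t0.
have tL : 0 <= t - last_reset N t w.
  by rewrite subr_ge0; exact: last_reset_le.
have [d2 d20 cB] := within_continuous_dist (@continuous_B (N t w)) tL e0.
have d0 : 0 < Num.min d1 d2 by rewrite lt_min d10 d20.
have [m0 hm] := mesh_lt T d0.
exists m0 => m mm; have := hm _ mm; rewrite lt_min => /andP[hd1 hd2].
have h0 := mesh_gt0 m T0; set h := mesh T m in h0 hd1 hd2 *.
rewrite /staircase -/h; set i := (Num.truncn (t / h)).+1.
have /andP[ti1 ti2] := truncn_itv (divr_ge0 t0 (ltW h0)).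
have ti : t < i%:R * h <= t + h.
  rewrite -ltr_pdivrMr// ti2/= /i -natr1 mulrDl mul1r lerD2r.
  by rewrite -ler_pdivlMr.
have Ni : N (i%:R * h) w = N t w.
  apply: rc; last by case/andP: ti.
  by rewrite /ball /= distrC ger0_norm; move: ti; lra.
rewrite WE// /position /cnt Ni; apply: cB; first exact: age_ge0.
by apply: le_lt_trans (age_close h0 t0 Ni ti) _.
Qed.

Local Notation mu := lebesgue_measure.

Let cell (m i : nat) : set R := `[i%:R * mesh T m, i.+1%:R * mesh T m[%classic.

Lemma staircase_cellE m t : `[0, T[%classic t -> staircase m t =
  \sum_(i < m.+1) position N B (mesh T m) i.+1 w * \1_(cell m i) t.
Proof.
rewrite /= in_itv/= => /andP[t0 tT]; have h0 := mesh_gt0 m T0.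
have /andP[ti1 ti2] := truncn_itv (divr_ge0 t0 (ltW h0)).
have im : (Num.truncn (t / mesh T m) < m.+1)%N.
  rewrite -(ltr_nat R); apply: (le_lt_trans ti1).
  by rewrite /mesh invf_div mulrA ltr_pdivrMr// mulrC ltr_pM2l.
rewrite /staircase (bigD1 (Ordinal im))//= big1 ?addr0.
  rewrite indicE mem_set ?mulr1// /cell /= in_itv/=.
  by rewrite -ler_pdivlMr// -ltr_pdivrMr// ti1.
move=> i /eqP ne; rewrite indicE memNset ?mulr0// /cell /= in_itv/=.
rewrite -ler_pdivlMr// -ltr_pdivrMr// => /andP[a b].
apply: ne; apply: val_inj => /=.
have := lt_le_trans ti2; have := le_lt_trans a ti2; have := le_lt_trans ti1 b.
by rewrite !ltr_nat !ltnS => ? ? _; apply/eqP; rewrite eqn_leq; apply/andP.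
Qed.

(** Cell [i] carries the position of index [i.+1], for [i] from 0 to [m]; adding the null position
    of index 0 gives a sum of [m.+2] terms. *)
Lemma integral_staircase m :
  (\int[mu]_(t in `[0%R, T[) (staircase m t)%:E = (riemann_sum N B (mesh T m) m.+2 w)%:E)%E.
Proof.
have h0 := mesh_gt0 m T0.
under eq_integral => t tT.
  rewrite staircase_cellE; last by rewrite inE in tT.
  rewrite -sumEFin; over.
have iI i : mu.-integrable `[0%R, T[%classic
    (fun t => (position N B (mesh T m) i.+1 w * \1_(cell m i) t)%:E).
  under [X in integrable _ _ X]eq_fun do rewrite EFinM.
  apply: integrableZl => //.
  apply: (integrableS measurableT) => //; exact: integrable_indic_itv.
rewrite integral_sum//.
rewrite /riemann_sum [in RHS]big_ord_recl (position0 N (mesh T m) bmB) mulr0 add0r -sumEFin.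
apply: eq_bigr => i _; under eq_integral do rewrite EFinM.
rewrite integralZl//; last first.
  apply: (integrableS measurableT) => //; exact: integrable_indic_itv.
have mcell : measurable (cell m i) by exact: measurable_itv.
rewrite integral_indic// setIidl; last first.
  move=> t; rewrite /cell /= !in_itv /= => /andP[a b]; apply/andP; split.
    by apply: le_trans a; rewrite mulr_ge0// ltW.
  apply: (lt_le_trans b); rewrite /mesh mulrA ler_pdivrMr// mulrC ler_pM2l//.
  by rewrite ler_nat.
have mucell : mu (cell m i) = (mesh T m)%:E.
  rewrite /cell lebesgue_measure_itv/= lte_fin ltr_pM2r// ltr_nat ltnSn.
  rewrite -EFinB; congr EFin; rewrite -[i.+1%:R]natr1; ring.
transitivity ((position N B (mesh T m) i.+1 w)%:E * mu (cell m i))%E => //.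
by rewrite mucell -EFinM mulrC.
Qed.

(** Dominated convergence in time, for a fixed path. The right endpoint is left out because the
    staircase there would look at a grid time beyond [T]. *)
Lemma riemann_sum_cvg_area :
  riemann_sum N B (mesh T m) m.+2 w @[m --> \oo] --> area W T w.
Proof.
have [M M0 PM] := pieces_bounded.
have mD : measurable (`[0, T[%classic : set R) by [].
have ms m : measurable_fun `[0, T[%classic (fun t => (staircase m t)%:E).
  apply: (@eq_measurable_fun _ _ _ _ _ (fun t =>
     (\sum_(i < m.+1) position N B (mesh T m) i.+1 w * \1_(cell m i) t)%:E)).
    by move=> t; rewrite inE => tT; rewrite staircase_cellE.
  apply/measurable_EFinP; apply: measurable_sum => i.
  by apply: measurable_funM => //; apply: measurable_indic; exact: measurable_itv.
have cvgs t : `[0, T[%classic t -> (staircase m t)%:E @[m --> \oo] --> (W t w)%:E.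
  move=> /=; rewrite in_itv/= => /andP[t0 _].
  by apply: cvg_EFin; [exact: nearW|exact: staircase_cvg].
(* Measurability of the path in time is inherited from the staircases. *)
have mW : measurable_fun `[0, T[%classic (fun t => (W t w)%:E).
  by apply: (emeasurable_fun_cvg _ _ ms).
have iM : mu.-integrable `[0, T[%classic (fun=> M%:E).
  apply/integrableP; split => //.
  by rewrite integral_cst//= lebesgue_measure_itv/= lte_fin T0 -EFinB -EFinM ltry.
have bs m t : `[0, T[%classic t -> (`|(staircase m t)%:E| <= M%:E)%E.
  move=> /=; rewrite in_itv/= => /andP[t0 tT]; rewrite lee_fin.
  have /andP[ti1 _] := truncn_itv (divr_ge0 t0 (ltW (mesh_gt0 m T0))).
  have im : ((Num.truncn (t / mesh T m)).+1 <= m.+1)%N.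
    rewrite -(ltr_nat R); apply: (le_lt_trans ti1).
    by rewrite /mesh invf_div mulrA ltr_pdivrMr// mulrC ltr_pM2l.
  by have [kN aT] := position_pieces im; exact: PM.
have iW : mu.-integrable `[0, T[%classic (fun t => (W t w)%:E).
  apply: le_integrable iM => // t /=; rewrite in_itv/= => /andP[t0 tT].
  rewrite lee_fin (ger0_norm M0) WE//; apply: PM.
    by apply: (pp_nondecreasing ppN) => //; exact: ltW.
  rewrite subr_ge0 last_reset_le//= (le_trans _ (ltW tT))// lerBlDr lerDl.
  exact: last_reset_ge0.
have cvgI : (\int[mu]_(t in `[0%R, T[) (staircase m t)%:E)%E @[m --> \oo] -->
    (\int[mu]_(t in `[0%R, T[) (W t w)%:E)%E.
  by apply: (@dominated_cvg _ _ _ mu _ mD _ _ (fun=> M%:E)).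
rewrite /area -Rintegral_itv_bndo_bndc// /Rintegral.
have fW : (\int[mu]_(t in `[0%R, T[) (W t w)%:E)%E \is a fin_num.
  exact: (integrable_fin_num _ iW).
rewrite -(fineK fW) in cvgI; have /= cvgF := fine_cvg cvgI.
have -> : (fun m => riemann_sum N B (mesh T m) m.+2 w) =
    (fun m => fine (\int[mu]_(t in `[0%R, T[) (staircase m t)%:E)%E).
  by apply/funext => m; rewrite integral_staircase.
exact: cvgF.
Qed.

End pathwise.

(** * Passage to the limit *)

Section moment_convergence.
Context (d : measure_display) (Omega : measurableType d) (R : realType)
  (P : probability Omega R) (X : nat -> Omega -> R) (A : Omega -> R).
Hypothesis aX : forall m, all_moments P (X m).
Hypothesis cvgX : forall w, X m w @[m --> \oo] --> A w.
Hypothesis boundX : forall k, exists C, forall m,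
  mean P (fun w => X m w ^+ (2 * k)) <= C.

Let mA : measurable_fun setT A.
Proof.
apply: (@measurable_fun_cvg _ _ _ _ X) => [m|w _]; last exact: cvgX.
exact: all_moments_measurable (aX m).
Qed.

Let even_ge0 k (x : R) : 0 <= x ^+ (2 * k).
Proof. by rewrite exprM exprn_ge0// sqr_ge0. Qed.

Let cvgXX n w : X m w ^+ n @[m --> \oo] --> A w ^+ n.
Proof.
elim: n => [|n ih]; first exact: cvg_cst.
rewrite exprS (_ : (fun m => X m w ^+ n.+1) = (fun m => X m w * X m w ^+ n)).
  by apply: cvgM => //; exact: cvgX.
by apply/funext => m; rewrite exprS.
Qed.

(** Fatou's lemma transfers the uniform bound on the even moments to the limit. *)
Let integrable_even k : P.-integrable setT (EFin \o (fun w => A w ^+ (2 * k))).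
Proof.
have [C HC] := boundX k.
have mAk : measurable_fun setT (fun w => A w ^+ (2 * k)) by exact: measurable_funX.
apply/integrableP; split; first exact/measurable_EFinP.
under eq_integral do rewrite /= ger0_norm//.
pose f m w := (X m w ^+ (2 * k))%:E.
have mf m : measurable_fun setT (f m).
  apply/measurable_EFinP; apply: measurable_funX.
  exact: all_moments_measurable (aX m).
have f0 m w : setT w -> (0 <= f m w)%E by rewrite lee_fin.
have := fatou P measurableT mf f0.
rewrite (_ : (fun w => limn_einf (f^~ w)) = (fun w => (A w ^+ (2 * k))%:E)); last first.
  apply/funext => w.
  have cf : (f^~ w) @ \oo --> (A w ^+ (2 * k))%:E.
    by apply: cvg_EFin; [exact: nearW|exact: cvgXX].
  by rewrite (cvg_limn_einf_sup cf).
move=> h; apply: le_lt_trans h _.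
apply: (@le_lt_trans _ _ C%:E); last exact: ltry.
rewrite (_ : (fun m => _) = (fun m => (mean P (fun w => X m w ^+ (2 * k)))%:E)); last first.
  apply/funext => m; rewrite /mean /Rintegral fineK//.
  apply: integrable_fin_num => //.
  by apply: all_moments_integrable; exact: all_momentsX.
rewrite limn_einf_lim; apply: lime_le; first exact: is_cvg_einfs.
apply: nearW => n; apply: (@le_trans _ _ (mean P (fun w => X n w ^+ (2 * k)))%:E).
  by apply: ereal_inf_lbound; exists n => /=.
by rewrite lee_fin.
Qed.

Lemma all_moments_limit : all_moments P A.
Proof.
split=> // k; apply: (@integrable_le _ _ _ P _ (fun w => 1 + A w ^+ (2 * k))).
- by apply: measurable_funX; apply: measurableT_comp.
- move=> w; rewrite normrX normr_id mulnC exprM -[X in 1 + X]real_normK ?num_real// normrX.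
  set a := _ ^+ k; have : 0 <= (a - 1) ^+ 2 + a ^+ 2 + 1 by rewrite !addr_ge0// sqr_ge0.
  nra.
- apply: (@integrableD _ _ _ _ _ measurableT (fun=> 1%:E) (fun w => (A w ^+ (2 * k))%:E)).
    exact: finite_measure_integrable_cst.
  exact: integrable_even.
Qed.

(* The difference [D] of the powers satisfies [D <= min(D, K) + D ^+ 2 / K], where
   the first term has vanishing mean and the mean of [D ^+ 2] is bounded. *)
Lemma mean_pow_cvg n :
  mean P (fun w => X m w ^+ n) @[m --> \oo] --> mean P (fun w => A w ^+ n).
Proof.
have [C HC] := boundX n.
have aA := all_moments_limit.
have aXn m := all_momentsX n (aX m); have aAn := all_momentsX n aA.
pose D m w : R := `|X m w ^+ n - A w ^+ n|.
have aD0 m : all_moments P (fun w => X m w ^+ n - A w ^+ n).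
  under eq_fun do rewrite -mulN1r.
  by apply: all_momentsD => //; apply: all_momentsM => //; exact: all_moments_cst.
have aD m : all_moments P (D m).
  case: (aD0 m) => mm im; split; first exact: measurableT_comp.
  by move=> k; apply: eq_integrable (im k) => // w _; rewrite /= normr_id.
pose C' : R := 2 * C + 2 * mean P (fun w => A w ^+ (2 * n)).
have D2 m : mean P (fun w => D m w ^+ 2) <= C'.
  have aX2 := all_momentsX (2 * n) (aX m); have aA2 := all_momentsX (2 * n) aA.
  apply: (@le_trans _ _ (mean P (fun w => 2 * X m w ^+ (2 * n) + 2 * A w ^+ (2 * n)))).
    apply: mean_le; first exact: all_momentsX.
      by apply: all_momentsD; apply: all_momentsM => //; exact: all_moments_cst.
    move=> w; rewrite /D real_normK ?num_real// ![(2 * n)%N]mulnC !exprM.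
    set x := X m w ^+ n; set y := A w ^+ n.
    by have := sqr_ge0 (x + y); rewrite sqrrD sqrrB; lra.
  rewrite meanD ?meanZ//; try by apply: all_momentsM => //; exact: all_moments_cst.
  by rewrite /C' lerD2r ler_wpM2l.
have C'0 : 0 <= C' by apply: le_trans (D2 0%N); apply: mean_ge0 => w; exact: sqr_ge0.
apply: cvg_dist_le => e e0.
(* Chosen so that [C' / K <= e / 2]; the added 1 keeps [K] positive when [C'] is 0. *)
pose K : R := 2 * (C' + 1) / e; have K0 : 0 < K by rewrite divr_gt0// mulr_gt0//; lra.
pose F m w : R := Num.min (D m w) K.
have F0 m w : 0 <= F m w by rewrite le_min normr_ge0 ltW.
have FK m w : `|F m w| <= K by rewrite ger0_norm// ge_min lexx orbT.
have mF m : measurable_fun setT (F m).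
  apply: measurable_minr => //; exact: all_moments_measurable (aD m).
have aF m : all_moments P (F m) by exact: (@all_moments_bounded _ _ _ P K _ (mF m) (FK m)).
have cvgF : mean P (F m) @[m --> \oo] --> (0 : R).
  have cF w : (F m w)%:E @[m --> \oo] --> (0 : \bar R)%E.
    apply: cvg_EFin; first exact: nearW.
    apply: cvg_dist_le => e' e'0.
    have /cvgrPdist_le /(_ _ e'0) [m0 _ hm0] := @cvgXX n w.
    exists m0 => m mm; rewrite subr0 /= ger0_norm//.
    apply: le_trans (hm0 m mm); rewrite distrC ge_min; apply/orP; left.
    exact: lexx.
  have H : (\int[P]_w (F m w)%:E)%E @[m --> \oo] --> (\int[P]_w (cst 0 w))%E.
    apply: (@dominated_cvg _ _ _ P _ measurableT _ _ (fun=> K%:E)) => //.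
    - by move=> m; exact/measurable_EFinP.
    - exact: finite_measure_integrable_cst.
    - by move=> m w _; rewrite lee_fin.
  rewrite integral0 in H; have := fine_cvg H.
  exact.
have /cvgrPdist_le /(_ (e / 2)) := cvgF.
move=> /(_ (divr_gt0 e0 (ltr0n _ 2))) [m0 _ hm0]; exists m0 => m mm.
have := hm0 m mm; rewrite sub0r normrN => Fe.
have -> : mean P (fun w => X m w ^+ n) - mean P (fun w => A w ^+ n) =
    mean P (fun w => X m w ^+ n - A w ^+ n).
  rewrite -mulN1r -meanZ// -meanD//; last by apply: all_momentsM => //; exact: all_moments_cst.
  by congr (mean P _); apply/funext => w; rewrite mulN1r.
apply: le_trans (norm_mean_le (aD0 m)) _; rewrite -/(D m).
have aKD : all_moments P (fun w => K^-1 * D m w ^+ 2).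
  by apply: all_momentsM; [exact: all_moments_cst|exact: all_momentsX].
apply: (@le_trans _ _ (mean P (fun w => F m w + K^-1 * D m w ^+ 2))).
  apply: mean_le => //; first exact: all_momentsD.
  move=> w; rewrite /F; have d0 : 0 <= D m w by exact: normr_ge0.
  case: (leP (D m w) K) => DK; first by rewrite lerDl mulr_ge0 ?sqr_ge0// invr_ge0 ltW.
  rewrite -[leLHS]add0r; apply: lerD; first exact: ltW.
  by rewrite mulrC ler_pdivlMr// expr2 ler_wpM2l// ltW.
rewrite meanD// meanZ; last exact: all_momentsX.
have : K^-1 * mean P (fun w => D m w ^+ 2) <= e / 2.
  apply: (@le_trans _ _ (K^-1 * C')); first by rewrite ler_wpM2l ?invr_ge0 ?(ltW K0).
  rewrite mulrC ler_pdivrMr// /K.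
  have -> : e / 2 * (2 * (C' + 1) / e) = C' + 1 by field; rewrite gt_eqF.
  by rewrite lerDl.
have := ler_norm (mean P (F m)); lra.
Qed.

End moment_convergence.

(** * Moments of the area *)

Section area_moments.
Context (d : measure_display) (Omega : measurableType d) (R : realType)
  (P : probability Omega R) (r : R) (N : R -> {RV P >-> nat})
  (B : nat -> R -> {RV P >-> R}) (W : R -> Omega -> R).
Hypothesis r0 : 0 < r.
Hypothesis ppN : poisson_process r N.
Hypothesis bmB : forall k, standard_brownian_motion (B k).
Hypothesis indNB : mutually_independent P (fun i : option nat =>
  if i is Some k then sigma_process (B k : R -> Omega -> R)
  else sigma_process (N : R -> Omega -> nat)).
Hypothesis WE : forall t w, 0 <= t -> W t w = B (N t w) (t - last_reset N t w) w.
Context (T : R).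
Hypothesis T0 : 0 < T.

(** This shift makes every mesh at most 1, as the moment bounds and the schemes require. *)
Let m0 := (Num.truncn T).+1.
Let h m := mesh T (m + m0).
Let X m := riemann_sum N B (h m) (m + m0).+2.
(** The Riemann sum has one term more than needed to reach [T]: its index corresponds to time
    [T + h m], at most [T + 1]. *)
Let L := T + 1.
Let L0 : 0 <= L. Proof. by rewrite addr_ge0// ltW. Qed.

Let h_gt0 m : 0 < h m. Proof. exact: mesh_gt0. Qed.

Let h_le1 m : h m <= 1.
Proof.
rewrite /h /mesh ler_pdivrMr// mul1r.
have /andP[_ /ltW Tm] := truncn_itv (ltW T0); apply: (le_trans Tm).
by rewrite ler_nat /m0 addnS !ltnS (leq_trans (leq_addl m _)).
Qed.

Let h_end m : (m + m0).+2%:R * h m = T + h m.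
Proof. by rewrite -natr1 mulrDl mul1r {1}/h /mesh mulrC divfK. Qed.

Let h_endL m : (m + m0).+2%:R * h m <= L.
Proof. by rewrite h_end lerD2l. Qed.

Let aX m : all_moments P (X m).
Proof. exact: (all_moments_riemann_sum ppN bmB indNB (h_gt0 m)). Qed.

Let cvgX w : X m w @[m --> \oo] --> area W T w.
Proof.
have := @riemann_sum_cvg_area _ _ _ _ _ _ _ _ ppN bmB WE w T T0.
by rewrite -(cvg_shiftn m0).
Qed.

Let mean_X n m : mean P (fun w => X m w ^+ n) =
  mixed_moment N B (h m) n 0 (m + m0).+2.
Proof.
by rewrite /mixed_moment; congr (mean P _); apply/funext => w; rewrite expr0 mulr1.
Qed.

Let boundX k : exists C, forall m, mean P (fun w => X m w ^+ (2 * k)) <= C.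
Proof.
case: k => [|k].
  by exists 1 => m; under eq_fun do rewrite muln0 expr0; rewrite mean_cst.
exists (expR (growth R k.+1 * L)) => m; rewrite mean_X.
apply: le_trans (ler_norm _) _.
apply: (@le_trans _ _ (moment_sum N B (h m) k.+1 (m + m0).+2)).
  by apply: (mixed_moment_le ppN bmB indNB (h_gt0 m)); rewrite addn0.
apply: le_trans (moment_sum_le r0 ppN bmB indNB (h_gt0 m) (h_le1 m) _ _) _ => //.
by rewrite ler_expR ler_wpM2l ?growth_ge0.
Qed.

Let aA : all_moments P (area W T).
Proof. exact: (all_moments_limit aX cvgX boundX). Qed.

Lemma moment_area n : moment P (area W T) n = (mean P (fun w => area W T w ^+ n))%:E.
Proof. by rewrite /moment expectation_mean//; exact: all_momentsX. Qed.

Let mean_area_limit n (l : R) :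
  mixed_moment N B (h m) n 0 (m + m0).+2 @[m --> \oo] --> l ->
  mean P (fun w => area W T w ^+ n) = l.
Proof.
move=> cl; have cA := @mean_pow_cvg _ _ _ P X _ aX cvgX boundX n.
transitivity (limn (fun m => mean P (fun w => X m w ^+ n))).
  by apply/esym/cvg_lim => //; exact: cA.
rewrite (_ : (fun m => _) = (fun m => mixed_moment N B (h m) n 0 (m + m0).+2)).
  by apply: cvg_lim => //; exact: cl.
by apply/funext => m; exact: mean_X.
Qed.

Lemma mean_area_odd n : odd n -> mean P (fun w => area W T w ^+ n) = 0.
Proof.
move=> on; apply: mean_area_limit.
under eq_cvg do rewrite (mixed_moment_odd r0 ppN bmB indNB (h_gt0 _)) ?addn0//.
exact: cvg_cst.
Qed.

(** Two errors of order [h] add up: that of the scheme, and the shift from [T + h m] back to [T],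
    controlled by the Lipschitz constant. *)
Let close_limit (u : R -> nat -> R) (f : R -> R) :
  lipschitz_on L f -> close_family L u f ->
  u (h m) (m + m0).+2 @[m --> \oo] --> f T.
Proof.
move=> [K K0 Kf] [C C0 Cu]; apply: cvg_dist_le => e e0.
have KC0 : 0 < K + C + 1 by rewrite ltr_wpDl// addr_ge0.
have [m1 hm1] := mesh_lt T (divr_gt0 e0 KC0); exists m1 => m mm.
have hm : h m < e / (K + C + 1) by apply: hm1; rewrite (leq_trans mm)// leq_addr.
have TL : 0 <= T <= L by rewrite (ltW T0)/= lerDl.
have ThL : 0 <= T + h m <= L by rewrite addr_ge0 ?(ltW T0) ?(ltW (h_gt0 m))//= lerD2l.
have := Cu _ _ (h_gt0 m) (h_le1 m) (h_endL m); rewrite h_end => H1.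
have := Kf _ _ ThL TL; rewrite [T + h m - T]addrAC subrr add0r (gtr0_norm (h_gt0 m)) => H2.
apply: (@le_trans _ _ ((K + C + 1) * h m)); last first.
  by rewrite mulrC -ler_pdivlMr// ltW.
have -> : u (h m) (m + m0).+2 - f T =
  (u (h m) (m + m0).+2 - f (T + h m)) + (f (T + h m) - f T) by ring.
apply: le_trans (ler_normD _ _) _; have := h_gt0 m; lra.
Qed.

Let u a b h j := mixed_moment N B h a b j.

Let u_init a b h' : 0 < h' -> (0 < a + b)%N -> u a b h' 0 = 0.
Proof.
move=> _; rewrite /u (mixed_moment_init _ _ bmB).
by case: a => [|a]; case: b => [|b] //= _; rewrite ?expr0n ?mul0r ?mulr0.
Qed.

Lemma mean_area_sqr :
  mean P (fun w => area W T w ^+ 2) = second_moment r T.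
Proof.
apply: mean_area_limit; apply: (@close_limit (u 2 0%N) _ (lipschitz_on_second_moment r L0)).
apply: (close_20 r0 L0 u_init) => h' j h'0 h'1.
- by rewrite /u (mixed_moment_rec02 r0 ppN bmB indNB h'0) mixed_moment00 mulr1.
- exact: (mixed_moment_rec11 r0 ppN bmB indNB h'0).
- exact: (mixed_moment_rec20 ppN bmB indNB h'0).
Qed.

Lemma mean_area_fourth :
  mean P (fun w => area W T w ^+ 4) = fourth_moment r T.
Proof.
apply: mean_area_limit; apply: (@close_limit (u 4 0%N) _ (lipschitz_on_fourth_moment r L0)).
apply: (@close_40 _ _ r0 _ L0 u (fun h j => step_moment N B h 4 j) u_init).
(* The constant of [step_moment_even_le] for the fourth moment. *)
- exists (2`!%:R * 4 ^+ 2 * Num.sqrt 2); first by rewrite !mulr_ge0.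
  move=> h' j h'0 _ _; rewrite normrM normfV [X in _ / X]ger0_norm ?sqr_ge0//.
  rewrite ler_pdivrMr ?exprn_gt0// ger0_norm.
    exact: (step_moment_even_le ppN bmB indNB h'0 2).
  by apply: mean_ge0 => w; rewrite (exprM _ 2 2) sqr_ge0.
- move=> h' j h'0 h'1.
  by rewrite /u (mixed_moment_rec02 r0 ppN bmB indNB h'0) mixed_moment00 mulr1.
- by move=> h' j h'0 h'1; exact: (mixed_moment_rec11 r0 ppN bmB indNB h'0).
- by move=> h' j h'0 h'1; exact: (mixed_moment_rec20 ppN bmB indNB h'0).
- move=> h' j h'0 h'1.
  by rewrite /u (mixed_moment_rec04 r0 ppN bmB indNB h'0) mixed_moment00 mulr1.
- by move=> h' j h'0 h'1; exact: (mixed_moment_rec13 r0 ppN bmB indNB h'0).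
- by move=> h' j h'0 h'1; exact: (mixed_moment_rec22 r0 ppN bmB indNB h'0).
- by move=> h' j h'0 h'1; exact: (mixed_moment_rec31 r0 ppN bmB indNB h'0).
- by move=> h' j h'0 h'1; exact: (mixed_moment_rec40 ppN bmB indNB h'0).
Qed.

(** It vanishes at 0, and its derivative is positive at positive times because [expR x > 1 + x]
    makes [G11] positive there. *)
Lemma second_moment_gt0 : 0 < second_moment r T.
Proof.
have dsm := is_derive_second_moment r0.
have csm : {within `[0, T], continuous (second_moment r)}.
  by apply: derivable_within_continuous => t _; case: (dsm t).
have [c] := MVT T0 (fun t _ => dsm t) csm.
rewrite in_itv/= => /andP[c0 _].
have -> : second_moment r 0 = 0 by rewrite /second_moment !mulr0 oppr0 expR0; ring.
rewrite !subr0 => ->; rewrite mulr_gt0// mulr_gt0// mulr_gt0 ?expR_gt0//.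
have rc0 : 0 < r * c by exact: mulr_gt0.
rewrite divr_gt0 ?exprn_gt0//.
by have := expR_gt1Dx (negbT (gt_eqF rc0)); lra.
Qed.

(* With [s] the second moment, [x ^+ 2 <= s / 2 + x ^+ (2 k) / (s / 2) ^+ (k - 1)], so a
   vanishing moment of order [2 k] would give [s <= s / 2]. *)
Lemma mean_area_even k : mean P (fun w => area W T w ^+ (2 * k)) != 0.
Proof.
case: k => [|k].
  by under eq_fun do rewrite muln0 expr0; rewrite mean_cst oner_eq0.
apply/negP => /eqP z; have := second_moment_gt0; rewrite -mean_area_sqr => s0.
set s := mean P _ in s0; have e0 : 0 < s / 2 by rewrite divr_gt0.
have a2 := all_momentsX 2 aA; have ak := all_momentsX (2 * k.+1) aA.
suff : s <= s / 2 by rewrite ler_pdivlMr// ; lra.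
have -> : s / 2 = mean P (fun w => s / 2 + (s / 2) ^- k * area W T w ^+ (2 * k.+1)).
  rewrite meanD; [|exact: all_moments_cst|by apply: all_momentsM => //; exact: all_moments_cst].
  by rewrite mean_cst meanZ// z mulr0 addr0.
apply: mean_le => //.
  by apply: all_momentsD; [exact: all_moments_cst|apply: all_momentsM => //; exact: all_moments_cst].
move=> w; set a := area W T w; have a20 := sqr_ge0 a.
rewrite exprM [(a ^+ 2) ^+ k.+1]exprS; case: (leP (a ^+ 2) (s / 2)) => ae.
  apply: (le_trans ae); rewrite lerDl mulr_ge0 ?invr_ge0 ?exprn_ge0 ?(ltW e0)//.
  by rewrite mulr_ge0// exprn_ge0.
rewrite -[leLHS]add0r; apply: lerD; first exact: ltW.
rewrite mulrCA -[leLHS]mulr1 ler_wpM2l// mulrC ler_pdivlMr ?exprn_gt0// mul1r.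
by apply: lerXn2r; rewrite ?nnegrE ?(ltW e0) ?(ltW ae).
Qed.

End area_moments.

Theorem theorem5p1 (d : measure_display) (Omega : measurableType d)
    (R : realType) (P : probability Omega R) (r : R) (W : R -> Omega -> R)
    (hr : 0 < r) (hW : reset_brownian_motion P r W) (T : R) (hT : 0 < T) :
  [/\ forall n : nat, odd n -> moment P (area W T) n = 0%E,
      forall n : nat, ~~ odd n ->
        moment P (area W T) n \is a fin_num /\
        moment P (area W T) n <> 0%E,
      moment P (area W T) 2 =
        (2 / r ^+ 3 * (r * T - 2 + expR (- (r * T)) * (2 + r * T)))%:E &
      moment P (area W T) 4 =
        (1 / r ^+ 6 *
         (12 * (r * T) ^+ 2 + 120 * (r * T) - 840
          + expR (- (r * T)) *
            (9 * (r * T) ^+ 4 + 68 * (r * T) ^+ 3 + 288 * (r * T) ^+ 2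
             + 720 * (r * T) + 840)))%:E].
Proof.
case: hW => N [B [ppN bmB indNB WE]].
have mE n := moment_area hr ppN bmB indNB WE hT n.
split.
- by move=> n on; rewrite mE (mean_area_odd hr ppN bmB indNB WE hT).
- move=> n en; rewrite mE; split=> // -[].
  have <- : (2 * n./2 = n)%N by rewrite mul2n even_halfK.
  exact/eqP/(mean_area_even hr ppN bmB indNB WE hT).
- by rewrite mE (mean_area_sqr hr ppN bmB indNB WE hT).
- by rewrite mE (mean_area_fourth hr ppN bmB indNB WE hT).
Qed.
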